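(* Let $n\ge 2$, let $1\le p_i\le\infty$ for $i=1,\dots,n$ with $p_n\ge 2$ and $$n-\frac32\le\frac1{p_1}+\cdots+\frac1{p_n}.$$ Let $E_1,\dots,E_n$ be Banach spaces over $\mathbb{K}$ such that $E_n'$ has the Littlewood-Orlicz property, let $A\in\mathcal{L}(E_1,\dots,E_n;\mathbb{K})$, and let $0<p\le\infty$ satisfy $$n-\frac32\le\frac1{p_1}+\cdots+\frac1{p_n}-\frac1p.$$ Then $\hat A\colon \ell_{p_1}^w(E_1)\times\cdots\times\ell_{p_n}^w(E_n)\to\ell_p$ is bounded. In other words, $\mathcal{L}(E_1,\dots,E_n;\mathbb{K})=\Pi_{(p;p_1,\dots,p_n)}(E_1,\dots,E_n;\mathbb{K})$. Moreover $\|\hat A\|\le\|A\|$.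
   Context: $\mathbb{K}=\mathbb{R}$ or $\mathbb{C}$. $E'$ is the topological dual of $E$ and $B_E$ its closed unit ball. $\mathcal{L}(E_1,\dots,E_n;F)$ is the Banach space of continuous $n$-linear maps $E_1\times\cdots\times E_n\to F$. For $0<p\le\infty$, $\ell_p^w(E)$ is the space of sequences $(x_j)_j$ in $E$ with $(\varphi(x_j))_j\in\ell_p$ for all $\varphi\in E'$, with $\|(x_j)_j\|_{\ell_p^w(E)}=\sup_{\varphi\in B_{E'}}(\sum_j|\varphi(x_j)|^p)^{1/p}$ (usual modification if $p=\infty$). For $A\in\mathcal{L}(E_1,\dots,E_n;F)$ and spaces of sequences $X_i$ in $E_i$ and $Y$ in $F$, ''$\hat A\colon X_1\times\cdots\times X_n\to Y$ is bounded'' means that $\hat A((x_j^1)_j,\dots,(x_j^n)_j):=(A(x_j^1,\dots,x_j^n))_j$ is well defined with values in $Y$ and continuous; $\|\hat A\|$ is its norm as a multilinear map. For $\frac1p\le\frac1{p_1}+\cdots+\frac1{p_n}$, $A$ is absolutely $(p;p_1,\dots,p_n)$-summing if there is $C>0$ with $\|(A(x_j^1,\dots,x_j^n))_j\|_{p}\le C\prod_{i=1}^n\|(x_j^i)_j\|_{\ell_{p_i}^w(E_i)}$ for all finite families (equivalently $\hat A\colon\ell_{p_1}^w(E_1)\times\cdots\times\ell_{p_n}^w(E_n)\to\ell_p(F)$ is bounded); $\Pi_{(p;p_1,\dots,p_n)}(E_1,\dots,E_n;F)$ is the space of all such maps. A Banach space $E$ has the Littlewood-Orlicz property if $\ell_1^w(E)$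 is continuously contained in the (completed) projective tensor product $\ell_2\otimes_\pi E$, where the latter is viewed as a space of $E$-valued sequences via $(x_j)_j\leftrightarrow\sum_j e_j\otimes x_j$.
   Formalization: The estimate ‖Â‖ ≤ ‖A‖ fails in general (e.g. E_1=E_2=ℓ_∞^2 over ℝ, p_1=p=1, p_2=2); what is proved is ‖Â‖ ≤ C‖A‖ for every C bounding the norm of the inclusion of ℓ_1^w(E_n') in ℓ_2⊗_π E_n'. *)

(* Defs.v *)
From HB Require Import structures.
From mathcomp Require Import all_boot all_order all_algebra.
From mathcomp Require Import all_classical all_reals all_analysis.
From mathcomp Require Import complex.

Set Implicit Arguments.
Unset Strict Implicit.
Unset Printing Implicit Defensive.
Import Order.TTheory GRing.Theory Num.Theory.
Import numFieldNormedType.Exports.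
Local Open Scope classical_set_scope.
Local Open Scope ring_scope.

Variant base_field := RealField | ComplexField.

Definition scalars (R : realType) (k : base_field) : numFieldType :=
  match k with RealField => R | ComplexField => R[i] end.

Section RealNorm.
Context (R : realType) (k : base_field).
Local Notation K := (scalars R k).

(* Norms of K-vector spaces take values in K, as nonnegative elements;
   [real_of] brings them back to R. *)
Definition real_of : K -> R :=
  match k return scalars R k -> R with
  | RealField => fun x => x
  | ComplexField => fun z : R[i] => complex.Re z
  end.

Definition of_real : R -> K :=
  match k return R -> scalars R k with
  | RealField => fun x => x
  | ComplexField => fun x : R => (x%:C)%C
  end.

Definition rnorm (V : normedModType K) (v : V) : R := real_of `|v|.

Lemma of_realK : cancel of_real real_of.
Proof. by rewrite /of_real /real_of /scalars; case: k. Qed.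

Lemma of_realD x y : of_real (x + y) = of_real x + of_real y.
Proof. rewrite /of_real /scalars; case: k => //=; exact: rmorphD. Qed.

Lemma of_realM x y : of_real (x * y) = of_real x * of_real y.
Proof. rewrite /of_real /scalars; case: k => //=; exact: rmorphM. Qed.

Lemma ler_of_real x y : (of_real x <= of_real y) = (x <= y).
Proof. by rewrite /of_real /scalars; case: k => //=; rewrite lecR. Qed.

Lemma of_real0 : of_real 0 = 0.
Proof. by rewrite /of_real /scalars; case: k. Qed.

Lemma rnormE (V : normedModType K) (v : V) : of_real (rnorm v) = `|v|.
Proof.
have := normr_ge0 v; rewrite /rnorm /of_real /real_of; move: `|v|.
case: k => [//|] z z0.
suff: forall z : R[i], 0 <= z -> (complex.Re z)%:C%C = z by apply.
by case=> a b; rewrite lecE /= => /andP[/eqP->].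
Qed.

Lemma rnorm_ge0 (V : normedModType K) (v : V) : 0 <= rnorm v.
Proof. by rewrite -ler_of_real of_real0 rnormE. Qed.

Lemma rnormD (V : normedModType K) (u v : V) :
  rnorm (u + v) <= rnorm u + rnorm v.
Proof. by rewrite -ler_of_real of_realD !rnormE ler_normD. Qed.

Lemma rnormZ (V : normedModType K) (a : K) (v : V) :
  rnorm (a *: v) = rnorm (a : K^o) * rnorm v.
Proof. by apply: (can_inj of_realK); rewrite of_realM !rnormE normrZ. Qed.

Lemma rnorm_eq0 (V : normedModType K) (v : V) : rnorm v = 0 -> v = 0.
Proof.
by move=> v0; apply/eqP; rewrite -normr_eq0 -rnormE v0 of_real0.
Qed.

Lemma rnorm0 (V : normedModType K) : rnorm (0 : V) = 0.
Proof. by apply: (can_inj of_realK); rewrite rnormE normr0 of_real0. Qed.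

Lemma of_real1 : of_real 1 = 1.
Proof. by rewrite /of_real /scalars; case: k. Qed.

Lemma rnorm1 : rnorm (1 : K^o) = 1.
Proof. by apply: (can_inj of_realK); rewrite rnormE normr1 of_real1. Qed.

Lemma rnorm_of_real (x : R) : rnorm (of_real x : K^o) = `|x|.
Proof.
have h y : 0 <= y -> rnorm (of_real y : K^o) = y.
  move=> y0; apply: (can_inj of_realK); rewrite rnormE ger0_norm//.
  by rewrite -of_real0 ler_of_real.
have [x0|/ltW x0] := leP 0 x; first by rewrite h// ger0_norm.
have of_realN y : of_real (- y) = - of_real y.
  by apply/eqP; rewrite -subr_eq0 opprK -of_realD addNr of_real0.
rewrite ler0_norm// -(h (- x)) ?oppr_ge0//.
by apply: (can_inj of_realK); rewrite !rnormE of_realN normrN.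
Qed.
End RealNorm.

Section Dual.
Context (R : realType) (k : base_field).
Local Notation K := (scalars R k).
Variable E : normedModType K.

Definition continuous_functionals : {pred E -> K^o} :=
  [pred f : E -> K^o | `[< linear f /\ continuous f >]].

Lemma continuous_functionals_submod : submod_closed continuous_functionals.
Proof.
split.
  apply/asboolP; split; first by move=> a x y; rewrite /= scaler0 addr0.
  exact: cst_continuous.
move=> a f g /asboolP[lf cf] /asboolP[lg cg]; apply/asboolP; split.
  move=> b x y; rewrite !fctE lf lg !scalerDr addrACA !scalerA.
  by rewrite [(a * b)%R]mulrC.
move=> x; apply: cvgD; last exact: cg.
by apply: cvgZr; exact: cf.
Qed.

HB.instance Definition _ := GRing.isSubmodClosed.Build K (E -> K^o)
  continuous_functionals continuous_functionals_submod.

Record dual := Dual {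
  dual_fun :> E -> K^o;
  dual_funP : dual_fun \in continuous_functionals }.

HB.instance Definition _ := [isSub for dual_fun].
HB.instance Definition _ := [Choice of dual by <:].
HB.instance Definition _ := [SubChoice_isSubLmodule of dual by <:].

Definition dual_norm (f : dual) : R :=
  sup [set rnorm (f x) | x in [set x : E | rnorm x <= 1]].

Lemma dual_linear (f : dual) : linear f.
Proof. by have /asboolP[] := dual_funP f. Qed.

Lemma dual_continuous (f : dual) : continuous f.
Proof. by have /asboolP[] := dual_funP f. Qed.

Lemma dual_fun0 (f : dual) : f 0 = 0.
Proof.
by have := dual_linear f (-1) 0 0; rewrite !scaleN1r !addNr.
Qed.

Lemma dual_funZ (f : dual) a x : f (a *: x) = a *: f x.
Proof. by rewrite -[a *: x]addr0 dual_linear dual_fun0 addr0. Qed.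

Lemma dual_bounded (f : dual) :
  has_sup [set rnorm (f x) | x in [set x : E | rnorm x <= 1]].
Proof.
split; first by exists (rnorm (f 0)), 0 => //=; rewrite rnorm0.
have /cvgrPdist_le/(_ 1 ltr01) := @dual_continuous f 0.
rewrite dual_fun0 => /nbhs_norm0P[d /= d0 fd].
have t0 : 0 < d / 2 by rewrite divr_gt0.
exists (rnorm ((d / 2)^-1 : K^o)) => _ [x /= x1 <-].
have : rnorm (f ((d / 2) *: x)) <= 1.
  rewrite -(ler_of_real k) rnormE of_real1 -normrN -sub0r; apply: fd.
  rewrite /= normrZ gtr0_norm// (le_lt_trans (y := d / 2))//.
    by rewrite ler_piMr ?(ltW t0)// -rnormE -(of_real1 R k) ler_of_real.
  by rewrite ltr_pdivrMr// ltr_pMr// ltr1n.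
rewrite dual_funZ => h.
rewrite -[f x](scalerK (lt0r_neq0 t0)) rnormZ.
by rewrite ler_piMr ?rnorm_ge0.
Qed.

Lemma dual_norm_ub (f : dual) x : rnorm x <= 1 -> rnorm (f x) <= dual_norm f.
Proof. by move=> x1; apply: ub_le_sup; [case: (dual_bounded f)|exists x]. Qed.

Lemma dual_norm_le (f : dual) (M : R) :
  (forall x, rnorm x <= 1 -> rnorm (f x) <= M) -> dual_norm f <= M.
Proof.
move=> fM; apply: ge_sup; first by case: (dual_bounded f).
by move=> _ [x x1 <-]; exact: fM.
Qed.

Let norm (f : dual) : K := of_real k (dual_norm f).

Lemma dual_norm_ge0 (f : dual) : 0 <= dual_norm f.
Proof.
apply: le_trans (rnorm_ge0 (f 0)) _; apply: dual_norm_ub.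
by rewrite rnorm0.
Qed.

Let dual_normD (f g : dual) : norm (f + g) <= norm f + norm g.
Proof.
rewrite /norm -of_realD ler_of_real; apply: dual_norm_le => x x1.
by rewrite (le_trans (rnormD _ _))// lerD// dual_norm_ub.
Qed.

Let dual_normZ (a : K) (f : dual) : norm (a *: f) = `|a| * norm f.
Proof.
rewrite -[`|a|](rnormE (a : K^o)) -of_realM; congr (of_real _ _).
have le1 (b : K) (g : dual) : dual_norm (b *: g) <= rnorm (b : K^o) * dual_norm g.
  apply: dual_norm_le => x x1; rewrite [X in rnorm X](_ : _ = b *: g x)//.
  by rewrite rnormZ ler_wpM2l ?rnorm_ge0// dual_norm_ub.
apply/eqP; rewrite eq_le le1/=.
have [->|a0] := eqVneq a 0.
  by rewrite rnorm0 mul0r dual_norm_ge0.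
have := le1 a^-1 (a *: f); rewrite scalerA mulVf// scale1r => h.
rewrite (le_trans (ler_wpM2l (rnorm_ge0 _) h))// mulrA -rnormZ.
by rewrite [a *: _](_ : _ = 1) ?rnorm1 ?mul1r// /GRing.scale/= divff.
Qed.

Let dual_norm_eq0 (f : dual) : norm f = 0 -> f = 0.
Proof.
rewrite /norm -(of_real0 R k) => /(can_inj (@of_realK R k)) f0.
apply/val_inj/funext => x /=; have [->|x0] := eqVneq x 0.
  exact: dual_fun0.
have nx0 : rnorm x != 0 by apply: contra_neq x0; exact: rnorm_eq0.
pose c : K := of_real k (rnorm x)^-1.
have : rnorm (f (c *: x)) <= 0.
  rewrite -f0; apply: dual_norm_ub.
  by rewrite rnormZ rnorm_of_real ger0_norm ?invr_ge0 ?rnorm_ge0// mulVf.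
rewrite dual_funZ rnormZ rnorm_of_real pmulr_rle0; last first.
  by rewrite normr_gt0 invr_neq0.
by move=> fx0; apply: rnorm_eq0; apply/eqP; rewrite eq_le fx0 rnorm_ge0.
Qed.

HB.instance Definition _ := Lmodule_isNormed.Build K dual
  dual_normD dual_normZ dual_norm_eq0.

Lemma rnorm_dualE (f : dual) : rnorm f = dual_norm f.
Proof. exact: of_realK. Qed.

End Dual.

Section SequenceSpaces.
Context (R : realType) (k : base_field).
Local Notation K := (scalars R k).
Implicit Types p : \bar R.
Local Open Scope ereal_scope.

Definition lp_norm (F : normedModType K) p (x : nat -> F) : \bar R :=
  Lnorm counting p (fun j => (rnorm (x j))%:E).

Definition lp (F : normedModType K) p : set (nat -> F) :=
  [set x | lp_norm p x < +oo].

Definition weak_lp (E : normedModType K) p : set (nat -> E) :=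
  [set x | forall f : dual E, lp p (fun j => f (x j))].

Definition weak_lp_norm (E : normedModType K) p (x : nat -> E) : \bar R :=
  ereal_sup [set lp_norm p (fun j => f (x j))
            | f in [set f : dual E | (rnorm f <= 1)%R]].

End SequenceSpaces.

Section ProjectiveTensor.
Context (R : realType) (k : base_field).
Local Notation K := (scalars R k).
Variable E : normedModType K.
Local Open Scope ereal_scope.

(* The algebraic tensor product of l_2 and E embeds in the E-valued sequences
   by letting a (x) y be the sequence (a_j y)_j.  The projective norm of u is
   +oo when u is not the image of a tensor (infimum of the empty set). *)
Definition proj_norm (u : nat -> E) : \bar R :=
  ereal_inf [set t | exists (m : nat) (a : 'I_m -> nat -> K^o) (y : 'I_m -> E),
    [/\ forall i, lp 2%:E (a i),
        forall j, u j = (\sum_(i < m) a i j *: y i)%R &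
        t = \sum_(i < m) lp_norm 2%:E (a i) * (rnorm (y i))%:E]].

(* e_0 (x) x_0 + ... + e_(N-1) (x) x_(N-1) *)
Definition tensor_section (x : nat -> E) (N : nat) : nat -> E :=
  fun j => if (j < N)%N then x j else 0%R.

(* x belongs to the completion when the series of the e_j (x) x_j converges
   there, that is, when its partial sums form a Cauchy sequence for the
   projective norm; the norm of the sum is then the limit of their norms. *)
Definition l2_proj : set (nat -> E) :=
  [set x | forall e : R, (0 < e)%R -> exists N0 : nat, forall N M : nat,
    (N0 <= N)%N -> (N0 <= M)%N ->
    proj_norm (tensor_section x N \- tensor_section x M)%R <= e%:E].

Definition l2_proj_norm (x : nat -> E) : \bar R :=
  limn (fun N => proj_norm (tensor_section x N)).

(* The inclusion of l_1^w(E) in the completed projective tensor product exists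
   and has norm at most C.  The constant is tracked because it enters the bound
   for induced maps: for E = l_1^2 over the reals (the dual of l_oo^2) it cannot
   be 1, and the form (x, y) |-> x_0 (y_0 + y_1) + x_1 (y_0 - y_1) on l_oo^2,
   of norm 2, induces a map l_1^w x l_2^w -> l_1 of norm at least 2 sqrt 2. *)
Definition littlewood_orlicz_with (C : R) : Prop :=
  forall x : nat -> E, weak_lp 1 x ->
    l2_proj x /\ l2_proj_norm x <= C%:E * weak_lp_norm 1 x.

Definition littlewood_orlicz : Prop := exists C, littlewood_orlicz_with C.

End ProjectiveTensor.

Section Multilinear.
Context (R : realType) (k : base_field).
Local Notation K := (scalars R k).
Variables (n : nat) (E : 'I_n -> completeNormedModType K) (F : normedModType K).
Implicit Types (A : (forall i, E i) -> F) (p : \bar R) (ps : 'I_n -> \bar R).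
Local Open Scope ereal_scope.

Definition multilinear A : Prop :=
  forall (x : forall i, E i) (i : 'I_n), linear (fun t : E i => A (dfwith x i t)).

Definition continuous_multilinear : set ((forall i, E i) -> F) :=
  [set A | multilinear A /\ continuous (A : prod_topology E -> F)].

Definition multilinear_norm A : \bar R :=
  ereal_sup [set (rnorm (A x))%:E
            | x in [set x : forall i, E i | forall i, (rnorm (x i) <= 1)%R]].

Definition hat A (x : forall i, nat -> E i) : nat -> F :=
  fun j => A (fun i => x i j).

Definition weak_lp_prod ps : set (forall i, nat -> E i) :=
  [set x | forall i, weak_lp (ps i) (x i)].

Definition hat_bounded p ps A : Prop :=
  (forall x, weak_lp_prod ps x -> lp p (hat A x)) /\
  forall x, weak_lp_prod ps x -> forall e : R, (0 < e)%R ->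
    exists2 d : R, (0 < d)%R & forall y, weak_lp_prod ps y ->
      (forall i, weak_lp_norm (ps i) (y i \- x i)%R < d%:E) ->
      lp_norm p (hat A y \- hat A x)%R < e%:E.

Definition hat_norm p ps A : \bar R :=
  ereal_sup [set lp_norm p (hat A x)
            | x in [set x | weak_lp_prod ps x /\
                            forall i, weak_lp_norm (ps i) (x i) <= 1]].

(* Finite families are the sequences that vanish from some rank on. *)
Definition absolutely_summing p ps : set ((forall i, E i) -> F) :=
  [set A | [/\ continuous_multilinear A, p^-1 <= \sum_(i < n) (ps i)^-1 &
     exists2 C : R, (0 < C)%R &
       forall (m : nat) (x : forall i, nat -> E i),
         (forall i j, (m <= j)%N -> x i j = 0%R) ->
         lp_norm p (hat A x) <=
           C%:E * \prod_(i < n) weak_lp_norm (ps i) (x i)]].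

End Multilinear.

Arguments continuous_multilinear {R k n} E F.
Arguments absolutely_summing {R k n} E F p ps.

(* Main.v *)
Require Import Defs.
From mathcomp Require Import all_boot all_order all_algebra.
From mathcomp Require Import all_classical all_reals all_analysis.
From mathcomp Require Import complex ring lra.

(* Put d_i = 1 - 1/p_i for i < n and d_n = 1/2 - 1/p_n, so that the d_i are
   nonnegative with sum at most 1 - 1/p.  By duality, the l_p norm of a sequence g
   is the supremum of sum_j b_j^(1 - 1/p) |g_j| over finitely supported
   nonnegative weights b of total mass at most 1.  Distributing the weight as
   x^i_j |-> b_j^(d_i) x^i_j, Hoelder's inequality reduces the theorem to
   p_1 = ... = p_(n-1) = 1, p_n = 2 and p = 1.

   In that case view A as an (n-1)-linear map with values in E_n'.  Averaging
   over signs (Defant-Voigt), the sequence u_j = A(x^1_j, ..., x^(n-1)_j, .) is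
   weakly 1-summable in E_n' with norm at most |A| prod_(i < n) |x^i|_(1,w).  The
   Littlewood-Orlicz property puts u in the projective tensor product of l_2 and
   E_n', whose elements pair with weakly 2-summable sequences of E_n.

   That the weak l_p norms are finite is the uniform boundedness principle in the
   dual, proved by a gliding hump. *)

Set Implicit Arguments.
Unset Strict Implicit.
Unset Printing Implicit Defensive.
Import Order.TTheory GRing.Theory Num.Theory.
Import numFieldNormedType.Exports.
Local Open Scope classical_set_scope.
Local Open Scope ring_scope.

(** * Finite Hoelder inequalities and their duals *)

Section FiniteHoelder.
Context (R : realType).
Implicit Types (g b : nat -> R) (p : \bar R) (M : R).

(** With 0^0 = 1, splitting the exponent fails at base 0 only when nonzero exponents cancel;
    nonnegative exponents with sum 0 both vanish. *)
Lemma powRD_ge0 (x r s : R) : 0 <= r -> 0 <= s -> x `^ (r + s) = x `^ r * x `^ s.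
Proof.
move=> r0 s0; have [rs0|rs0] := eqVneq (r + s) 0; last first.
  by rewrite powRD// (negbTE rs0).
have -> : r = 0 by lra.
have -> : s = 0 by lra.
by rewrite addr0 powRr0 mulr1.
Qed.

Lemma powR_le1 (x r : R) : 0 <= x <= 1 -> 0 <= r -> x `^ r <= 1.
Proof.
move=> /andP[x0 x1] r0; have := ge0_ler_powR r0 (x := x) (y := 1).
by rewrite powR1 !nnegrE; apply.
Qed.

(** For a base in [0, 1] powers decrease in the exponent. This splits one weight among the factors
    of a product. *)
Lemma powR_le_prod I (s : seq I) (d : I -> R) (x r : R) : 0 <= x <= 1 ->
  (forall i, 0 <= d i) -> \sum_(i <- s) d i <= r ->
  x `^ r <= \prod_(i <- s) x `^ d i.
Proof.
move=> x01 d0 dr.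
have <- : x `^ (\sum_(i <- s) d i) = \prod_(i <- s) x `^ d i.
  elim: s {dr} => [|i s IH]; first by rewrite !big_nil powRr0.
  by rewrite !big_cons powRD_ge0 ?IH// sumr_ge0.
rewrite -(subrKC (\sum_(i <- s) d i) r) powRD_ge0 ?sumr_ge0 ?subr_ge0//.
by rewrite ler_piMr ?powR_ge0// powR_le1// subr_ge0.
Qed.

(** Young's inequality with conjugate exponents 1/(1-t) and 1/t; at t = 0 and t = 1 one of them
    would be infinite. *)
Lemma young_powR (t u v : R) : 0 <= t <= 1 -> 0 <= u -> 0 <= v ->
  u `^ (1 - t) * v `^ t <= (1 - t) * u + t * v.
Proof.
move=> /andP[t0 t1] u0 v0.
have [->|tn0] := eqVneq t 0; first by rewrite subr0 powRr1// powRr0; lra.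
have [->|tn1] := eqVneq t 1; first by rewrite subrr powRr1// powRr0; lra.
have tp : 0 < t by rewrite lt_neqAle eq_sym tn0.
have t1p : 0 < 1 - t by rewrite subr_gt0 lt_neqAle tn1.
have := @conjugate_powR R (u `^ (1 - t)) (v `^ t) (1 - t)^-1 t^-1
  (powR_ge0 _ _) (powR_ge0 _ _).
rewrite !invr_gt0 !invrK -!powRrM !divff ?gt_eqF// !powRr1// => h.
by rewrite (mulrC (1 - t)) (mulrC t); apply: h => //; rewrite subrK.
Qed.

Lemma Lnorm_fin_leP (r M : R) g : 1 <= r -> 0 <= M -> (forall j, 0 <= g j) ->
  (Lnorm counting r%:E (EFin \o g) <= M%:E)%E <->
  forall N, \sum_(j < N) g j `^ r <= M `^ r.
Proof.
move=> r1 M0 g0; have r0 : 0 < r by rewrite (lt_le_trans ltr01).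
rewrite Lnorm_counting//.
under eq_eseriesr => k _ do rewrite /= ger0_norm//.
pose S := (\sum_(0 <= k <oo) (g k `^ r)%:E)%E.
rewrite -/S.
have S0 : (0 <= S)%E by apply: nneseries_ge0 => k _ _; rewrite lee_fin powR_ge0.
have -> : ((S `^ r^-1 <= M%:E)%E <-> (S <= (M `^ r)%:E)%E).
  split => h.
    have := @gt0_ler_poweR R r (ltW r0) (S `^ r^-1)%E M%:E.
    rewrite !in_itv/= !leey !andbT poweR_ge0 lee_fin M0 => /(_ erefl erefl h).
    by rewrite -poweRrM mulVf ?gt_eqF// poweRe1.
  have := @gt0_ler_poweR R r^-1 (ltW _) S (M `^ r)%:E.
  rewrite invr_gt0 !in_itv/= !leey !andbT S0 lee_fin powR_ge0.
  move=> /(_ r0 erefl erefl h) h'; rewrite (le_trans h')//.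
  by rewrite lee_fin -powRrM mulfV ?gt_eqF// powRr1.
split => [SM N|h].
  rewrite -lee_fin (le_trans _ SM)// -sumEFin.
  rewrite -(big_mkord xpredT (fun k => (g k `^ r)%:E)).
  by apply: nneseries_lim_ge => k _ _; rewrite lee_fin powR_ge0.
apply: lime_le.
  by apply: is_cvg_nneseries => k _ _; rewrite lee_fin powR_ge0.
by apply: nearW => N; rewrite big_mkord sumEFin lee_fin.
Qed.

(** The only null set of the counting measure is the empty one, so an essential bound holds at every
    index. *)
Lemma Lnorm_inf_leP M g : (forall j, 0 <= g j) ->
  (Lnorm counting +oo (EFin \o g) <= M%:E)%E <-> forall j, g j <= M.
Proof.
move=> g0; rewrite unlock.
(* At [+oo] the norm is an essential supremum only when the whole space has positive measure. *)
have cT : (0 < counting [set: nat] :> \bar R)%E.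
  by rewrite /counting asboolF//; exact: infinite_nat.
rewrite cT; split => [/ess_sup_inf.ess_supP[A [_ A0 hA]] j|h].
  apply: contrapT => /negP; rewrite -ltNge => gj.
  have : A j by apply: hA => /=; apply/negP; rewrite ger0_norm ?g0// -ltNge lte_fin.
  suff -> : A = set0 by [].
  apply: contrapT => /eqP/set0P[i Ai].
  move: A0; rewrite /= /counting.
  have [fA|fA] := pselect (finite_set A); last by rewrite asboolF.
  rewrite asboolT// => /eqP.
  rewrite eqe pnatr_eq0 finmap.cardfs_eq0 => /eqP/fset_set_set0 => /(_ fA) A0.
  by move: Ai; rewrite A0.
apply/ess_sup_inf.ess_supP/nearW => j /=; rewrite ger0_norm// lee_fin; exact: h.
Qed.

Lemma Lnorm_ge_term p g M j : (1 <= p)%E -> (forall j, 0 <= g j) -> 0 <= M ->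
  (Lnorm counting p (EFin \o g) <= M%:E)%E -> g j <= M.
Proof.
move=> + g0 M0; case: p => [r| |]//=; last by move=> _ /Lnorm_inf_leP; apply.
rewrite lee_fin => r1 /(Lnorm_fin_leP r1 M0 g0)/(_ j.+1) h.
have r0 : 0 < r by rewrite (lt_le_trans ltr01).
rewrite leNgt; apply/negP => /(gt0_ltr_powR r0); rewrite !nnegrE M0 g0 => /(_ erefl erefl).
apply/negP; rewrite -leNgt (le_trans _ h)// big_ord_recr/= lerDr.
by apply: sumr_ge0 => i _; exact: powR_ge0.
Qed.

Definition weights (N : nat) b := (forall j, 0 <= b j) /\ \sum_(j < N) b j <= 1.

Lemma weights_le1 N b (j : 'I_N) : weights N b -> b j <= 1.
Proof.
move=> [b0 b1]; apply: le_trans b1; rewrite (bigD1 j)//= lerDl.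
by apply: sumr_ge0 => i _.
Qed.

Lemma fine_inve_itv p : (1 <= p)%E -> 0 <= fine p^-1 <= 1.
Proof.
move: p => [r| |]//=; last by rewrite lexx ler01.
rewrite lee_fin => r1; have r0 : 0 < r by rewrite (lt_le_trans ltr01).
by rewrite inver gt_eqF//= invr_ge0 (ltW r0) invf_le1.
Qed.

(* Young's inequality in each term.  The case [s = 2] serves the last factor, which
   is only required to become weakly 2-summable. *)
Lemma weighted_sum_le p g M (s N : nat) b : (s%:R%:E <= p)%E -> (0 < s)%N ->
  (forall j, 0 <= g j) -> 0 <= M ->
  (Lnorm counting p (EFin \o g) <= M%:E)%E -> weights N b ->
  \sum_(j < N) b j `^ (1 - s%:R * fine p^-1) * g j ^+ s <= M ^+ s.
Proof.
move=> sp s0 g0 M0 gM [b0 b1].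
have [M_eq0|Mn0] := eqVneq M 0.
  rewrite big1 ?exprn_ge0// => j _; have : g j = 0.
    apply/eqP; rewrite eq_le g0 andbT -M_eq0.
    by apply: Lnorm_ge_term gM => //; rewrite (le_trans _ sp)// lee_fin ler1n.
  by move=> ->; rewrite expr0n gtn_eqF// mulr0.
have Mp : 0 < M by rewrite lt_neqAle eq_sym Mn0.
  rewrite -[leRHS]mul1r -ler_pdivrMr ?exprn_gt0// mulr_suml.
move: p sp gM => [r| |]//=.
- rewrite lee_fin => sr gM.
  have r0 : 0 < r by rewrite (lt_le_trans _ sr)// ltr0n.
  have r1 : 1 <= r by rewrite (le_trans _ sr)// ler1n.
  rewrite inver gt_eqF//=.
  have /= := (Lnorm_fin_leP r1 (ltW Mp) g0).1 gM N => SN.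
  set t := s%:R / r.
  have t01 : 0 <= t <= 1.
    by rewrite /t divr_ge0 ?ler0n ?(ltW r0)//= ler_pdivrMr// mul1r.
  have SN1 : \sum_(j < N) (g j / M) `^ r <= 1.
    rewrite -(ler_pM2r (powR_gt0 r Mp)) mul1r mulr_suml (le_trans _ SN)//.
    apply: ler_sum => j _; rewrite -powRM ?divr_ge0// ?(ltW Mp)//.
    by rewrite divfK ?gt_eqF.
  apply: (@le_trans _ _ (\sum_(j < N) ((1 - t) * b j + t * (g j / M) `^ r))).
    apply: ler_sum => j _.
    have -> : b j `^ (1 - t) * g j ^+ s / M ^+ s =
        b j `^ (1 - t) * ((g j / M) `^ r) `^ t.
      rewrite -powRrM /t mulrCA mulfV ?gt_eqF// mulr1 powR_mulrn.
        by rewrite expr_div_n mulrA.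
      by rewrite divr_ge0// ltW.
    by apply: young_powR => //; exact: powR_ge0.
  rewrite big_split/= -!mulr_sumr; case/andP: t01 => t0 t1.
  have : (1 - t) * \sum_(j < N) b j <= (1 - t) * 1 by rewrite ler_wpM2l// subr_ge0.
  have := ler_wpM2l t0 SN1; lra.
- move=> _ /Lnorm_inf_leP-/(_ g0) gM; rewrite mulr0 subr0.
  apply: le_trans b1; apply: ler_sum => j _; rewrite powRr1//.
  by rewrite ler_pdivrMr ?exprn_gt0// ler_wpM2l// lerXn2r// ?nnegrE// ltW.
Qed.

(* Duality: the weights [b_j = g_j^r / sum_i g_i^r] norm the truncations of [g]. *)
Lemma Lnorm_le_weighted p g M : (1 <= p)%E -> (forall j, 0 <= g j) -> 0 <= M ->
  (forall N b, weights N b ->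
    \sum_(j < N) b j `^ (1 - fine p^-1) * g j <= M) ->
  (Lnorm counting p (EFin \o g) <= M%:E)%E.
Proof.
move=> + g0 M0; case: p => [r| |]//=.
  rewrite lee_fin => r1; have r0 : 0 < r by rewrite (lt_le_trans ltr01).
  rewrite inver gt_eqF//= => H; apply/Lnorm_fin_leP => // N.
  set S := \sum_(j < N) _.
  have S0 : 0 <= S by apply: sumr_ge0 => j _; exact: powR_ge0.
  have [->|Sn0] := eqVneq S 0; first exact: powR_ge0.
  have Sp : 0 < S by rewrite lt_neqAle eq_sym Sn0.
  have /H : weights N (fun j => g j `^ r / S).
    split; first by move=> j; rewrite divr_ge0// powR_ge0.
    by rewrite -mulr_suml divff.
  (* Since r (1 - 1/r) + 1 = r, each term is g_j^r times S^-(1 - 1/r). *)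
  have -> : \sum_(j < N) (g j `^ r / S) `^ (1 - r^-1) * g j = S `^ r^-1.
    have -> : S `^ r^-1 = S * S^-1 `^ (1 - r^-1).
      rewrite -(powR_inv1 S0) -powRrM -{2}(powRr1 S0) -powRD ?Sn0 ?implybT//.
      by congr (_ `^ _); lra.
    rewrite [in RHS]/S mulr_suml; apply: eq_bigr => j _.
    rewrite powRM ?powR_ge0 ?invr_ge0// mulrAC; congr (_ * _).
    by rewrite -powRrM mulrBr mulr1 mulfV ?gt_eqF// mulrC mulr_powRB1.
  move=> h; have := @ge0_ler_powR R r (ltW r0) (S `^ r^-1) M.
  by rewrite !nnegrE powR_ge0 M0 -powRrM mulVf ?gt_eqF// powRr1//; apply.
move=> _ H; apply/Lnorm_inf_leP => // j.
(* For the supremum norm, the point mass at [j] isolates the term [g j]. *)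
have /H : weights j.+1 (fun i => (i == j)%:R).
  split; first by move=> i; exact: ler0n.
  rewrite big_ord_recr/= eqxx big1 ?add0r// => i _.
  by rewrite ltn_eqF.
rewrite subr0 big_ord_recr/= big1 ?add0r; last first.
  by move=> i _; rewrite powRr1// ltn_eqF// mul0r.
by rewrite eqxx powR1 mul1r.
Qed.

End FiniteHoelder.

(** * Scalars and functionals *)

Section Duality.
Context (R : realType) (k : base_field).
Local Notation K := (scalars R k).

Lemma rnormN (V : normedModType K) (v : V) : rnorm (- v) = rnorm v.
Proof. by rewrite /rnorm normrN. Qed.

Lemma rnormB (V : normedModType K) (u v : V) : rnorm (u - v) = rnorm (v - u).
Proof. by rewrite -rnormN opprB. Qed.

Lemma rnormM (a b : K) : rnorm (a * b : K^o) = rnorm (a : K^o) * rnorm (b : K^o).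
Proof. by rewrite -rnormZ. Qed.

Lemma rnorm_sum (V : normedModType K) I (r : seq I) (P : pred I) (F : I -> V) :
  rnorm (\sum_(i <- r | P i) F i) <= \sum_(i <- r | P i) rnorm (F i).
Proof.
elim/big_rec2 : _ => [|i x y _ h]; first by rewrite rnorm0.
by rewrite (le_trans (rnormD _ _))// lerD2l.
Qed.

Lemma of_real_sum I (r : seq I) (P : pred I) (F : I -> R) :
  of_real k (\sum_(i <- r | P i) F i) = \sum_(i <- r | P i) of_real k (F i).
Proof. exact: (big_morph _ (@of_realD R k) (of_real0 R k)). Qed.

(** Phases turn sums of moduli into values of linear expressions, over both fields at once. *)
Lemma phase (z : K^o) : exists2 c : K, rnorm (c : K^o) <= 1 &
  c * z = of_real k (rnorm z).
Proof.
have [->|z0] := eqVneq z 0.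
  by exists 0; [rewrite rnorm0|rewrite mul0r rnorm0 of_real0].
exists (`|z| / z); last by rewrite divfK// rnormE.
by rewrite -(ler_of_real k) rnormE of_real1 normrM normr_id normfV mulfV// normr_eq0.
Qed.

Lemma phase_seq (z : nat -> K^o) : exists2 c : nat -> K,
  forall j, rnorm (c j : K^o) <= 1 & forall j, c j * z j = of_real k (rnorm (z j)).
Proof.
have /choice[c cP] j : exists c : K, rnorm (c : K^o) <= 1 /\ c * z j = of_real k (rnorm (z j)).
  by have [c c1 cz] := phase (z j); exists c.
by exists c => j; have [] := cP j.
Qed.

(** Radii of balls live in K; a positive one equals its own norm and so comes from [R]. *)
Lemma real_of_gt0 (e : K) : 0 < e -> 0 < real_of e /\ of_real k (real_of e) = e.
Proof.
move=> e0; have eE : of_real k (real_of e) = e.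
  by rewrite -[in RHS](gtr0_norm e0) -(rnormE (e : K^o)) /rnorm gtr0_norm.
split => //; rewrite lt_neqAle -(ler_of_real k) of_real0 eE ltW// andbT.
by apply: contraTneq e0 => h; rewrite -eE -h of_real0 ltxx.
Qed.

Lemma rnorm_prod I (r : seq I) (F : I -> K) :
  rnorm (\prod_(i <- r) F i : K^o) = \prod_(i <- r) rnorm (F i : K^o).
Proof. exact: (big_morph _ (fun x y : K => rnormM x y) (rnorm1 R k)). Qed.

Lemma rnorm_le_eps (V : normedModType K) (v : V) :
  (forall e : R, 0 < e -> rnorm v <= e) -> v = 0.
Proof.
move=> h; apply: rnorm_eq0; apply/eqP; rewrite eq_le rnorm_ge0 andbT.
by apply/ler_addgt0Pr => e e0; rewrite add0r h.
Qed.

Section dual.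
Variable E : normedModType K.
Implicit Types (f g : dual E) (x : E).

Lemma linear_fun0 (f : E -> K^o) : linear f -> f 0 = 0.
Proof. by move=> lf; have := lf (-1) 0 0; rewrite !scaleN1r !addNr. Qed.

Lemma linear_funZ (f : E -> K^o) a x : linear f -> f (a *: x) = a *: f x.
Proof. by move=> lf; rewrite -[a *: x]addr0 lf linear_fun0// addr0. Qed.

Lemma linear_funD (f : E -> K^o) x y : linear f -> f (x + y) = f x + f y.
Proof. by move=> lf; rewrite -[x]scale1r lf !scale1r. Qed.

Lemma linear_fun_sum (f : E -> K^o) I (r : seq I) (P : pred I) (F : I -> E) :
  linear f -> f (\sum_(i <- r | P i) F i) = \sum_(i <- r | P i) f (F i).
Proof.
move=> lf; apply: (big_morph _ _ (linear_fun0 lf)) => x y.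
exact: linear_funD.
Qed.

Lemma mkdual (f : E -> K^o) (M : R) : linear f -> 0 <= M ->
  (forall x, rnorm (f x) <= M * rnorm x) ->
  exists2 g : dual E, dual_fun g = f & rnorm g <= M.
Proof.
move=> lf M0 fM.
have cf : continuous f.
  move=> x; apply/cvgrPdist_le => e e0.
  have [e'0 e'E] := real_of_gt0 e0; set e' := real_of e in e'0 e'E.
  near=> y.
  rewrite -[`|_|](rnormE (f x - f y : K^o)) -e'E ler_of_real.
  have -> : f x - f y = f (x - y).
    by rewrite linear_funD// -(scaleN1r y) linear_funZ// scaleN1r.
  apply: le_trans (fM _) _.
  apply: (@le_trans _ _ (M * (e' / (M + 1)))).
    apply: ler_wpM2l => //; near: y.
    have d0 : 0 < e' / (M + 1) by rewrite divr_gt0// ltr_wpDl.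
    have d0' : 0 < of_real k (e' / (M + 1)).
      rewrite lt_neqAle -[X in X <= _](of_real0 R k) ler_of_real (ltW d0) andbT.
      rewrite -[X in X != _](of_real0 R k) (inj_eq (can_inj (@of_realK R k))).
      by rewrite eq_sym gt_eqF.
    have /cvgrPdist_le/(_ _ d0') := @cvg_id _ (nbhs x).
    by apply: filterS => y; rewrite -rnormE ler_of_real.
  rewrite mulrCA ger_pMr// ler_pdivrMr ?ltr_wpDl// mul1r.
  by rewrite lerDl.
have fP : f \in @continuous_functionals R k E by apply/asboolP.
exists (Dual fP) => //.
rewrite rnorm_dualE; apply: dual_norm_le => x x1; apply: le_trans (fM x) _.
by rewrite ler_piMr.
Unshelve. all: by end_near. Qed.

Lemma dual_le f x : rnorm (f x) <= rnorm f * rnorm x.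
Proof.
have [->|x0] := eqVneq x 0; first by rewrite dual_fun0 !rnorm0 mulr0.
have nx0 : 0 < rnorm x.
  rewrite lt_neqAle rnorm_ge0 andbT eq_sym; apply: contra_neq x0.
  exact: rnorm_eq0.
rewrite -ler_pdivrMr// mulrC rnorm_dualE.
have : rnorm (of_real k (rnorm x)^-1 *: x) <= 1.
  by rewrite rnormZ rnorm_of_real gtr0_norm ?invr_gt0// mulVf ?gt_eqF.
move=> /(dual_norm_ub f); rewrite dual_funZ rnormZ rnorm_of_real.
by rewrite gtr0_norm ?invr_gt0.
Qed.

Lemma dual_funE f g a x : (a *: f + g) x = a *: f x + g x.
Proof. by []. Qed.

Lemma dual_ext f g : (forall x, f x = g x) -> f = g.
Proof. by move=> fg; apply/val_inj/funext. Qed.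

Lemma dual_sumE I (r : seq I) (P : pred I) (F : I -> dual E) x :
  (\sum_(i <- r | P i) F i) x = \sum_(i <- r | P i) F i x.
Proof. by elim/big_rec2 : _ => // i y g _ <-. Qed.

(* The norm of a functional is controlled by the unit ball of the dual, without
   the Hahn-Banach theorem: [f] is itself a multiple of a functional of norm 1. *)
Lemma linear_le_dual N (x : nat -> E) (m M : R) (f : E -> K^o) :
  (forall g, rnorm g <= 1 -> \sum_(j < N) rnorm (g (x j)) <= m) ->
  linear f -> 0 <= M -> (forall u, rnorm (f u) <= M * rnorm u) ->
  \sum_(j < N) rnorm (f (x j)) <= M * m.
Proof.
move=> xm lf M0 fM.
have [M_eq0|Mn0] := eqVneq M 0.
  rewrite M_eq0 mul0r big1// => j _; apply/eqP.
  by rewrite eq_le rnorm_ge0 andbT (le_trans (fM _))// M_eq0 mul0r.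
have Mp : 0 < M by rewrite lt_neqAle eq_sym Mn0.
have [g gE gM] := mkdual lf M0 fM.
have : rnorm (of_real k M^-1 *: g) <= 1.
  by rewrite rnormZ rnorm_of_real gtr0_norm ?invr_gt0// ler_pdivrMl// mulr1.
move=> /xm; rewrite -ler_pdivrMl// mulr_sumr; congr (_ <= _).
apply: eq_bigr => j _; rewrite -gE.
rewrite (_ : (of_real k M^-1 *: g) (x j) = of_real k M^-1 *: g (x j))//.
by rewrite rnormZ rnorm_of_real gtr0_norm ?invr_gt0.
Qed.

End dual.

End Duality.

(** * Uniform boundedness in the dual *)

Section UniformBoundedness.
Context (R : realType) (k : base_field).
Local Notation K := (scalars R k).

Lemma real_complete (u : nat -> R) :
  (forall e, 0 < e -> exists N, forall n, (N <= n)%N -> `|u n - u N| <= e) ->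
  exists l, forall e, 0 < e -> exists N, forall n, (N <= n)%N -> `|u n - l| <= e.
Proof.
move=> uC; have cu : cvgn u.
  apply: cauchy_cvg; apply: cauchy_exP => e e0.
  have e2 : 0 < e / 2 by rewrite divr_gt0.
  have [N uN] := uC _ e2; exists (u N).
  exists N => // n /= Nn; rewrite /ball/= distrC (le_lt_trans (uN _ Nn))//.
  by rewrite ltr_pdivrMr// ltr_pMr// ltr1n.
exists (limn u) => e e0; move/cvgrPdist_le : cu => /(_ _ e0)[N _ uN].
by exists N => n Nn; rewrite distrC; apply: uN.
Qed.

Lemma complex_norm_bounds (z : scalars R ComplexField) :
  [/\ `|complex.Re (z : R[i])| <= rnorm (z : (scalars R ComplexField)^o),
      `|complex.Im (z : R[i])| <= rnorm (z : (scalars R ComplexField)^o) &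
      rnorm (z : (scalars R ComplexField)^o) <=
        `|complex.Re (z : R[i])| + `|complex.Im (z : R[i])|].
Proof.
have -> : rnorm (z : (scalars R ComplexField)^o) =
    Num.sqrt (complex.Re (z : R[i]) ^+ 2 + complex.Im (z : R[i]) ^+ 2).
  exact: (congr1 (@complex.Re R) (normc_def (z : R[i]))).
case: z => a b /=; split.
- by rewrite -sqrtr_sqr ler_wsqrtr// lerDl sqr_ge0.
- by rewrite -sqrtr_sqr ler_wsqrtr// lerDr sqr_ge0.
- rewrite -[leRHS]ger0_norm ?addr_ge0// -sqrtr_sqr ler_wsqrtr//.
  rewrite sqrrD !real_normK ?num_real// -addrA [_ *+ 2 + _]addrC addrA lerDl.
  by rewrite mulrn_wge0// mulr_ge0.
Qed.

(** The complex case passes to real and imaginary parts: each is dominated by the modulus, which is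
    at most the sum of their absolute values. *)
Lemma scalars_complete (u : nat -> K^o) :
  (forall e, 0 < e -> exists N, forall n, (N <= n)%N -> rnorm (u n - u N) <= e) ->
  exists l : K^o, forall e, 0 < e ->
    exists N, forall n, (N <= n)%N -> rnorm (u n - l) <= e.
Proof.
move: u; case: k => u uC; first exact: real_complete.
have [|a ua] := @real_complete (fun n => complex.Re (u n : R[i])).
  move=> e e0; have [N uN] := uC _ e0; exists N => n Nn.
  apply: le_trans (uN _ Nn); have [+ _ _] := complex_norm_bounds (u n - u N).
  by rewrite raddfB.
have [|b ub] := @real_complete (fun n => complex.Im (u n : R[i])).
  move=> e e0; have [N uN] := uC _ e0; exists N => n Nn.
  apply: le_trans (uN _ Nn); have [_ + _] := complex_norm_bounds (u n - u N).
  by rewrite raddfB.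
exists (a +i* b)%C => e e0; have e2 : 0 < e / 2 by rewrite divr_gt0.
have [N uN] := ua _ e2; have [N' uN'] := ub _ e2.
exists (maxn N N') => n; rewrite geq_max => /andP[Nn N'n].
have [_ _] := complex_norm_bounds (u n - (a +i* b)%C).
move=> /le_trans; apply; rewrite [e]splitr !raddfB/=.
by rewrite lerD ?uN ?uN'.
Qed.

(** As 2b = (a + b) - (a - b), the vectors a + b and a - b cannot both be shorter than b. This
    decides the signs in the gliding hump. *)
Lemma rnorm_le_addsub (V : normedModType K) (a b : V) :
  rnorm (a + b) < rnorm b -> rnorm b <= rnorm (a - b).
Proof.
move=> h.
have := rnormD (a + b) (- (a - b)); rewrite rnormN.
have -> : a + b - (a - b) = of_real k 2 *: b.
  rewrite -[2]/(1 + 1) of_realD of_real1 scalerDl scale1r.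
  by rewrite opprB addrC addrA subrK.
by rewrite rnormZ rnorm_of_real ger0_norm//; lra.
Qed.

Variables (E : normedModType K) (Y : set E).
Hypothesis Y_bounded : forall f : dual E, exists M, forall y, Y y -> rnorm (f y) <= M.

Section gliding_hump.
Hypothesis Y_unbounded : forall M : R, exists (f : dual E) (y : E),
  [/\ rnorm f <= 1, Y y & M < rnorm (f y)].

(** The functional is within a factor 2 of the supremum of |g(y)| over the unit ball of the dual;
    this near-maximality later bounds the tail of the series at y. *)
Lemma almost_norming (M : R) : exists q : dual E * E,
  [/\ rnorm q.1 <= 1, Y q.2, M < rnorm (q.1 q.2) &
      forall g : dual E, rnorm g <= 1 -> rnorm (g q.2) <= 2 * rnorm (q.1 q.2)].
Proof.
have [f0 [y [f01 Yy Mf0]]] := Y_unbounded (Num.max M 0).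
pose A := [set rnorm (g y) | g in [set g : dual E | rnorm g <= 1]].
have supA : has_sup A.
  split; first by exists (rnorm (f0 y)), f0.
  exists (rnorm y) => _ [g /= g1 <-].
  by rewrite (le_trans (dual_le g y))// ler_piMl// rnorm_ge0.
have f0S : rnorm (f0 y) <= sup A by apply: ub_le_sup; [case: supA|exists f0].
move: Mf0; rewrite gt_max => /andP[Mf0 f00].
have S0 : 0 < sup A by rewrite (lt_le_trans f00).
(* The gap is chosen so that the functional found exceeds both M and half the supremum. *)
have e0 : 0 < sup A - Num.max M (sup A / 2).
  rewrite subr_gt0 gt_max (lt_le_trans Mf0)//=.
  by rewrite ltr_pdivrMr// ltr_pMr// ltr1n.
have [_ [f /= f1 <-]] := sup_adherent e0 supA.
rewrite opprB addrC subrK gt_max => /andP[Mf fS].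
exists (f, y); split => // g g1 /=.
have : rnorm (g y) <= sup A by apply: ub_le_sup; [case: supA|exists g].
by move: fS; rewrite ltr_pdivrMr// mulrC => /ltW fS /le_trans; apply.
Qed.

(** In the threshold 3 j 4^j, the power is cancelled by the weight 4^-j of the j-th term, and the
    factor 3 is there because only a third of the hump is sure to outlast the tail. *)
Let choice_seq := choice (fun j : nat => almost_norming (3 * (j%:R * 4 ^+ j))).
Let q : nat -> dual E * E := projT1 choice_seq.
Let psi j := (q j).1.
Let y j := (q j).2.
Let qP j : [/\ rnorm (psi j) <= 1, Y (y j), 3 * (j%:R * 4 ^+ j) < rnorm (psi j (y j)) &
  forall g : dual E, rnorm g <= 1 -> rnorm (g (y j)) <= 2 * rnorm (psi j (y j))].
Proof. exact: (projT2 choice_seq). Qed.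

Let t j : dual E := of_real k (4 ^- j) *: psi j.

Let tE j x : rnorm (t j x) = 4 ^- j * rnorm (psi j x).
Proof.
rewrite (_ : t j x = of_real k (4 ^- j) *: psi j x)// rnormZ rnorm_of_real.
by rewrite gtr0_norm// invr_gt0 exprn_gt0.
Qed.

(** Partial sums of a series with terms 4^-i psi_i up to sign, the sign being chosen at [y i] so
    that the earlier terms do not cancel the new one there. *)
Let Fixpoint phi (j : nat) : dual E := if j is i.+1 then
  if rnorm (t i (y i)) <= rnorm (phi i (y i) + t i (y i)) then phi i + t i
  else phi i - t i else 0.

Let phiS j : phi j.+1 = if rnorm (t j (y j)) <= rnorm (phi j (y j) + t j (y j))
  then phi j + t j else phi j - t j.
Proof. by []. Qed.

Let phi_large j : rnorm (t j (y j)) <= rnorm (phi j.+1 (y j)).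
Proof.
rewrite phiS; case: ifPn => //; rewrite -ltNge => h.
exact: (rnorm_le_addsub h).
Qed.

Let phi_step j x : rnorm (phi j.+1 x - phi j x) = rnorm (t j x).
Proof.
rewrite phiS; case: ifPn => _.
  by rewrite (_ : (phi j + t j) x = phi j x + t j x)// addrAC subrr add0r.
by rewrite (_ : (phi j - t j) x = phi j x - t j x)// addrAC subrr add0r rnormN.
Qed.

(** A geometric sum of ratio 1/4, whence 4/3 = 1/(1 - 1/4). The bound [B] is |x| for convergence and
    2 |psi_j(y_j)| for the tail at [y j]. *)
Let phi_cauchy x B m i : (forall l, rnorm (psi l x) <= B) ->
  rnorm (phi (m + i)%N x - phi m x) <= 4 / 3 * (4 ^- m - 4 ^- (m + i)) * B.
Proof.
move=> psiB; elim: i => [|i IH]; first by rewrite addn0 !subrr mulr0 mul0r rnorm0.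
rewrite addnS -(subrKA (phi (m + i)%N x)) (le_trans (rnormD _ _))//.
have := phi_step (m + i)%N x; rewrite tE => ->.
have := psiB (m + i)%N.
have : 0 < 4 ^- (m + i) :> R by rewrite invr_gt0 exprn_gt0.
move: IH; rewrite exprS invfM; move: (4 ^- (m + i)) (4 ^- m) => a b.
move: (rnorm (psi _ _)) => r IH a0 rB.
have := ler_wpM2l (ltW a0) rB; nra.
Qed.

Let phi_cauchy' x B m i : (forall l, rnorm (psi l x) <= B) ->
  rnorm (phi (m + i)%N x - phi m x) <= 4 / 3 * 4 ^- m * B.
Proof.
move=> psiB; apply: le_trans (phi_cauchy m i psiB) _.
rewrite ler_wpM2r//; first by rewrite (le_trans _ (psiB 0%N))// rnorm_ge0.
by rewrite ler_wpM2l// lerBlDr lerDl invr_ge0 exprn_ge0.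
Qed.

Let psi_le x l : rnorm (psi l x) <= rnorm x.
Proof.
have [psi1 _ _ _] := qP l.
by rewrite (le_trans (dual_le _ _))// ler_piMl// rnorm_ge0.
Qed.

Let phi_cvg x : exists l : K^o, forall e, 0 < e ->
  exists N, forall n, (N <= n)%N -> rnorm (phi n x - l) <= e.
Proof.
apply: scalars_complete => e e0.
have : (4 : R)^-1 ^+ n @[n --> \oo] --> 0.
  by apply: cvg_expr; rewrite ger0_norm// invf_lt1// ltr1n.
have c0 : 0 < e / (4 / 3 * (rnorm x + 1)).
  by rewrite divr_gt0// mulr_gt0// ltr_wpDl ?rnorm_ge0.
move=> /cvgrPdist_le/(_ _ c0)[N _ /(_ N (leqnn N))/=].
rewrite sub0r normrN ger0_norm ?exprn_ge0// exprVn => hN.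
exists N => n Nn; rewrite -(subnKC Nn) (le_trans (phi_cauchy' _ _ (psi_le x)))//.
move: hN; rewrite ler_pdivlMr ?mulr_gt0// ?ltr_wpDl ?rnorm_ge0//.
have : 0 < 4 ^- N :> R by rewrite invr_gt0 exprn_gt0.
nra.
Qed.

Let lim_phi x : K^o := sval (cid (phi_cvg x)).
Let lim_phiP x e : 0 < e ->
  exists N, forall n, (N <= n)%N -> rnorm (phi n x - lim_phi x) <= e.
Proof. exact: (svalP (cid (phi_cvg x))). Qed.

Let lim_phi_linear : linear lim_phi.
Proof.
move=> a u v; apply/eqP; rewrite -subr_eq0; apply/eqP/rnorm_le_eps => e e0.
have a0 : 0 < 3 * (rnorm (a : K^o) + 1) by rewrite mulr_gt0// ltr_wpDl ?rnorm_ge0.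
have e1 : 0 < e / (3 * (rnorm (a : K^o) + 1)) by rewrite divr_gt0.
have e3 : 0 < e / 3 by rewrite divr_gt0.
have [N1 h1] := lim_phiP (a *: u + v) e3.
have [N2 h2] := lim_phiP u e1.
have [N3 h3] := lim_phiP v e3.
set n := maxn N1 (maxn N2 N3).
have {}h1 : rnorm (phi n (a *: u + v) - lim_phi (a *: u + v)) <= e / 3.
  by apply: h1; rewrite leq_maxl.
have {}h2 : rnorm (phi n u - lim_phi u) <= e / (3 * (rnorm (a : K^o) + 1)).
  by apply: h2; rewrite (leq_trans _ (leq_maxr _ _))// leq_maxl.
have {}h3 : rnorm (phi n v - lim_phi v) <= e / 3.
  by apply: h3; rewrite (leq_trans _ (leq_maxr _ _))// leq_maxr.
have -> : lim_phi (a *: u + v) - (a *: lim_phi u + lim_phi v) =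
    - (phi n (a *: u + v) - lim_phi (a *: u + v)) +
    (a *: (phi n u - lim_phi u) + (phi n v - lim_phi v)).
  rewrite dual_linear scalerBr.
  move: (a *: phi n u) (phi n v) (lim_phi _) (a *: lim_phi u) (lim_phi v) => A B C D F.
  by rewrite opprB [X in _ = _ + X]addrACA -opprD addrA subrK.
rewrite (le_trans (rnormD _ _))// rnormN.
have := rnormD (a *: (phi n u - lim_phi u)) (phi n v - lim_phi v).
rewrite rnormZ.
have : rnorm (a : K^o) * rnorm (phi n u - lim_phi u) <= e / 3.
  apply: (@le_trans _ _ ((rnorm (a : K^o) + 1) * (e / (3 * (rnorm (a : K^o) + 1))))).
    by rewrite ler_pM// ?rnorm_ge0// lerDl.
  have an0 : rnorm (a : K^o) + 1 != 0 by rewrite gt_eqF// ltr_wpDl// rnorm_ge0.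
  by rewrite le_eqVlt; apply/orP; left; apply/eqP; field.
lra.
Qed.

Lemma gliding_hump : False.
Proof.
have phi_ub x : rnorm (lim_phi x) <= 4 / 3 * rnorm x.
  apply/ler_addgt0Pr => e e0; have [N /(_ N (leqnn N)) hN] := lim_phiP x e0.
  rewrite -(subrK (phi N x) (lim_phi x)) addrC (le_trans (rnormD _ _))//.
  rewrite [X in _ + X]rnormB lerD//.
  have := phi_cauchy' 0 N (psi_le x).
  by rewrite add0n subr0 expr0 invr1 mulr1.
have [f fE _] := mkdual lim_phi_linear (ltac:(by []) : 0 <= 4 / 3 :> R) phi_ub.
have [M fM] := Y_bounded f.
(* The unit above M pays for replacing the limit by a partial sum at [y j]. *)
pose j := (Num.truncn (M + 1)).+1.
have Mj : M + 1 < j%:R by exact: truncnS_gt.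
have [_ /fM + psi_large psi_norming] := qP j.
rewrite leNgt fE => /negP; apply.
have [N /(_ (maxn N j.+1) (leq_maxl _ _))] := lim_phiP (y j) ltr01.
(* This index is past N, hence close to the limit, and past j, hence includes the j-th hump. *)
have -> : maxn N j.+1 = (j.+1 + (maxn N j.+1 - j.+1))%N by rewrite subnKC// leq_maxr.
set i := (_ - _)%N.
have psi_le2 l : rnorm (psi l (y j)) <= 2 * rnorm (psi j (y j)).
  by apply: psi_norming; have [] := qP l.
have := phi_cauchy' j.+1 i psi_le2; have := phi_large j; rewrite tE.
have := rnormD (lim_phi (y j)) (phi (j.+1 + i)%N (y j) - lim_phi (y j)).
rewrite addrC subrK.
have := rnormD (phi (j.+1 + i)%N (y j)) (phi j.+1 (y j) - phi (j.+1 + i)%N (y j)).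
rewrite addrC subrK [X in _ + X]rnormB.
have p4 : 0 < 4 ^- j :> R by rewrite invr_gt0 exprn_gt0.
(* The hump h = 4^-j |psi_j(y_j)| loses at most (4/3) 4^-(j+1) 2 |psi_j(y_j)| = (2/3) h to the later
   terms, and h/3 > j. *)
have : j%:R < 4 ^- j * rnorm (psi j (y j)) / 3.
  rewrite ltr_pdivlMr// mulrC -ltr_pdivrMl// invrK mulrA (mulrC _ 3) -mulrA.
  by rewrite (mulrC (4 ^+ j)).
rewrite [4 ^+ j.+1]exprS invfM.
move: p4; move: (4 ^- j) => a a0; lra.
Qed.

End gliding_hump.

(** Banach-Steinhaus for the evaluations at the points of [Y], acting on the dual: its failure is
    what the gliding hump refutes. *)
Lemma uniform_boundedness : exists M : R, forall (f : dual E) y,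
  rnorm f <= 1 -> Y y -> rnorm (f y) <= M.
Proof.
apply: contrapT => H; apply: gliding_hump => M.
apply: contrapT => H'; apply: H; exists M => f y f1 Yy.
by rewrite leNgt; apply/negP => h; apply: H'; exists f, y.
Qed.

End UniformBoundedness.

(** * Finiteness of the weak l_p norms *)

Section WeakSummability.
Context (R : realType) (k : base_field).
Local Notation K := (scalars R k).
Implicit Types p : \bar R.

Lemma lp_norm_weighted (F : normedModType K) p (x : nat -> F) (M : R) N b :
  (1 <= p)%E -> 0 <= M -> (lp_norm p x <= M%:E)%E -> weights N b ->
  \sum_(j < N) b j `^ (1 - fine p^-1) * rnorm (x j) <= M.
Proof.
move=> p1 M0 xM bN.
have := @weighted_sum_le R p (fun j => rnorm (x j)) M 1 N b p1 isT _ M0 xM bN.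
rewrite mul1r expr1 => h; apply: le_trans (h _); last by move=> j; exact: rnorm_ge0.
by apply: ler_sum => j _; rewrite expr1.
Qed.

Lemma lp_norm_le_weighted (F : normedModType K) p (x : nat -> F) (M : R) :
  (1 <= p)%E -> 0 <= M ->
  (forall N b, weights N b ->
    \sum_(j < N) b j `^ (1 - fine p^-1) * rnorm (x j) <= M) ->
  (lp_norm p x <= M%:E)%E.
Proof. by move=> p1 M0; apply: Lnorm_le_weighted => // j; exact: rnorm_ge0. Qed.

Lemma lp_normE (F : normedModType K) p (x : nat -> F) : lp p x ->
  exists2 M : R, 0 <= M & lp_norm p x = M%:E.
Proof.
rewrite /lp/= => h; have h0 : (0 <= lp_norm p x)%E by exact: Lnorm_ge0.
exists (fine (lp_norm p x)); first exact: fine_ge0.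
by rewrite fineK// ge0_fin_numE.
Qed.

Variable E : normedModType K.

Lemma weak_lp_norm_le p (x : nat -> E) (y : \bar R) :
  (weak_lp_norm p x <= y)%E <->
  (forall f : dual E, rnorm f <= 1 ->
    (lp_norm p (fun j => f (x j)) <= y)%E).
Proof.
split=> [h f f1|h].
  by apply: le_trans h; apply: ereal_sup_ubound; exists f.
by apply: ge_ereal_sup => _ [f /= f1 <-]; exact: h.
Qed.

Lemma weak_lp_norm_ge0 p (x : nat -> E) : (0 <= weak_lp_norm p x)%E.
Proof.
have : rnorm (0 : dual E) <= 1 by rewrite rnorm0.
by move=> /((weak_lp_norm_le p x _).1 (lexx _)); apply: le_trans; exact: Lnorm_ge0.
Qed.

(** Uniform boundedness is applied to finite combinations of the [x j] with weights from l_p duality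
    and phases. On these a functional is bounded by the l_p norm of its values along [x], and
    suitable weights and phases recover that norm. *)
Lemma weak_lp_norm_fin p (x : nat -> E) : (1 <= p)%E -> weak_lp p x ->
  exists2 M : R, 0 <= M & weak_lp_norm p x = M%:E.
Proof.
move=> p1 xp.
pose w (b : nat -> R) (j : nat) : R := b j `^ (1 - fine p^-1).
pose Y := [set y : E | exists N b (c : nat -> K),
  [/\ weights N b, forall j, rnorm (c j : K^o) <= 1 &
      y = \sum_(j < N) (c j * of_real k (w b j)) *: x j]].
have fY N b (c : nat -> K) (f : dual E) :
    f (\sum_(j < N) (c j * of_real k (w b j)) *: x j) =
    \sum_(j < N) (c j * of_real k (w b j)) *: f (x j).
  rewrite linear_fun_sum; last exact: dual_linear.
  by apply: eq_bigr => j _; rewrite dual_funZ.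
have w0 b j : 0 <= w b j by exact: powR_ge0.
have [|M YM] := @uniform_boundedness R k E Y.
  move=> f; have [M M0 fxM] := lp_normE (xp f).
  exists M => _ [N [b [c [bN c1 ->]]]]; rewrite fY.
  apply: le_trans (rnorm_sum _ _ _) _.
  have fxM' : (lp_norm p (fun j => f (x j)) <= M%:E)%E by rewrite fxM.
  apply: le_trans (lp_norm_weighted p1 M0 fxM' bN); apply: ler_sum => j _.
  rewrite rnormZ rnormM rnorm_of_real ger0_norm ?w0//.
  by rewrite ler_wpM2r ?rnorm_ge0// ler_piMl// w0.
have xM (f : dual E) : rnorm f <= 1 ->
    (lp_norm p (fun j => f (x j)) <= (Num.max M 0)%:E)%E.
  move=> f1; apply: lp_norm_le_weighted => //; first by rewrite le_max lexx orbT.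
  move=> N b bN; rewrite le_max; apply/orP; left.
  have [c c1 cE] := phase_seq (fun j => f (x j)).
  have := YM f (\sum_(j < N) (c j * of_real k (w b j)) *: x j) f1.
  rewrite fY (_ : \sum_(j < N) _ = (of_real k (\sum_(j < N) w b j * rnorm (f (x j))))).
    rewrite rnorm_of_real ger0_norm; first apply.
      by exists N, b, c.
    by apply: sumr_ge0 => j _; rewrite mulr_ge0 ?w0 ?rnorm_ge0.
  rewrite of_real_sum; apply: eq_bigr => j _; rewrite of_realM -cE.
  by rewrite mulrCA mulrA.
have := weak_lp_norm_ge0 p x; move/weak_lp_norm_le : xM.
case: (weak_lp_norm p x) => // r _; rewrite lee_fin => r0; by exists r.
Qed.

End WeakSummability.

(** * The Defant-Voigt theorem *)

Section DefantVoigt.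
Context (R : realType) (k : base_field).
Local Notation K := (scalars R k).

(** The midpoint of a + s and a - s is a; this removes one random sign. *)
Lemma rnorm_le_mid (V : normedModType K) (a s : V) (T : R) :
  rnorm (a + s) <= T -> rnorm (a - s) <= T -> rnorm a <= T.
Proof.
move=> h1 h2; have := rnormD (a + s) (a - s).
have -> : a + s + (a - s) = of_real k 2 *: a.
  rewrite -[2]/(1 + 1) of_realD of_real1 scalerDl scale1r.
  by rewrite addrACA subrr addr0.
by rewrite rnormZ rnorm_of_real ger0_norm//; lra.
Qed.

(* Averaging over Rademacher signs, one sign at a time. *)
Lemma diagonal_le_signs N (D : nat -> nat -> K^o) (c : K^o) (T : R) :
  (forall r : nat -> K, (forall j, r j = 1 \/ r j = -1) ->
    rnorm (\sum_(j < N) \sum_(l < N) r j * r l * D l j + c : K^o) <= T) ->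
  rnorm (\sum_(j < N) D j j + c) <= T.
Proof.
elim: N c => [|N IH] c H.
  by have := H (fun=> 1) (fun=> or_introl erefl); rewrite !big_ord0.
(* The constant [c] absorbs the diagonal terms already split off. *)
rewrite big_ord_recr/= -addrA; apply: IH => r r1.
pose r' (e : K) j := if j == N then e else r j.
(* [Z] gathers the off-diagonal terms of the new row and column, which are linear in the new sign e;
   the new diagonal term carries e^2 = 1 and survives the averaging. *)
pose Z : K := \sum_(j < N) r j * D N j + \sum_(l < N) r l * D l N.
have QE e : e = 1 \/ e = -1 ->
    \sum_(j < N.+1) \sum_(l < N.+1) r' e j * r' e l * D l j =
    \sum_(j < N) \sum_(l < N) r j * r l * D l j + D N N + e * Z.
  move=> e1; have ee : e * e = 1 by case: e1 => ->; rewrite ?mulrNN mulr1.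
  have r'N j : (j < N)%N -> r' e j = r j by move=> jN; rewrite /r' ltn_eqF.
  have r'NN : r' e N = e by rewrite /r' eqxx.
  rewrite big_ord_recr/= [in X in _ + X]big_ord_recr/= r'NN ee mul1r.
  have -> : \sum_(l < N) e * r' e l * D l N = e * \sum_(l < N) r l * D l N.
    by rewrite mulr_sumr; apply: eq_bigr => l _; rewrite r'N//; ring.
  have -> : \sum_(j < N) \sum_(l < N.+1) r' e j * r' e l * D l j =
      \sum_(j < N) \sum_(l < N) r j * r l * D l j + e * \sum_(j < N) r j * D N j.
    rewrite mulr_sumr -big_split/=; apply: eq_bigr => j _.
    rewrite big_ord_recr/= r'N// r'NN; congr (_ + _); last by ring.
    by apply: eq_bigr => l _; rewrite r'N.
  by rewrite /Z; ring.
have r'1 e : e = 1 \/ e = -1 -> forall j, r' e j = 1 \/ r' e j = -1.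
  by move=> e1 j; rewrite /r'; case: ifP.
apply: (@rnorm_le_mid _ _ Z).
  have := H (r' 1) (r'1 _ (or_introl erefl)); rewrite QE; last by left.
  by rewrite mul1r -[_ + _ + Z + c]addrA (addrC Z) !addrA.
have := H (r' (-1)) (r'1 _ (or_intror erefl)); rewrite QE; last by right.
by rewrite mulN1r -[_ + _ - Z + c]addrA (addrC (- Z)) !addrA.
Qed.

Variables (n : nat) (E : 'I_n -> completeNormedModType K).
Implicit Types (B : (forall i, E i) -> K^o) (S : seq 'I_n) (x : forall i, E i).

Lemma dfwith_self x i : dfwith x i (x i) = x.
Proof.
apply: functional_extensionality_dep => j; have [<-|ij] := eqVneq i j.
  by rewrite dfwithin.
by rewrite dfwithout.
Qed.

Lemma dfwithC x i j (s : E i) (t : E j) : i != j ->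
  dfwith (dfwith x i s) j t = dfwith (dfwith x j t) i s.
Proof.
move=> ij; apply: functional_extensionality_dep => l.
have [<-|il] := eqVneq i l.
  by rewrite dfwithin dfwithout 1?eq_sym// dfwithin.
have [<-|jl] := eqVneq j l; first by rewrite dfwithin dfwithout// dfwithin.
by rewrite !dfwithout.
Qed.

Lemma prod_rnorm_dfwith S x i (t : E i) : i \notin S ->
  \prod_(j <- S) rnorm (dfwith x i t j) = \prod_(j <- S) rnorm (x j).
Proof.
move=> iS; apply: eq_big_seq => j jS; rewrite dfwithout//.
by apply: contraNneq iS => ->.
Qed.

(* [B] depends only on the coordinates in [S] and is multilinear in them.  The
   induction eliminates a coordinate [i] by substituting [sum_l r_l c_l x^i_l] for
   it, with signs [r] and phases [c]. *)
Lemma defant_voigt S B (M : R) (N : nat) (x : forall i, nat -> E i) (m : 'I_n -> R) :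
  S != [::] -> uniq S -> 0 <= M ->
  (forall i, i \in S -> forall y, linear (fun t : E i => B (dfwith y i t) : K^o)) ->
  (forall y z, (forall i, i \in S -> y i = z i) -> B y = B z) ->
  (forall y, rnorm (B y) <= M * \prod_(i <- S) rnorm (y i)) ->
  (forall i, i \in S -> 0 <= m i) ->
  (forall i, i \in S -> forall g : dual (E i), rnorm g <= 1 ->
    \sum_(j < N) rnorm (g (x i j)) <= m i) ->
  \sum_(j < N) rnorm (B (fun i => x i j)) <= M * \prod_(i <- S) m i.
Proof.
elim: S B M => // i S IH B M _ /= /andP[iS uS] M0 Blin Bdep BM m0 xm.
have iiS : i \in i :: S by rewrite mem_head.
pose f (y : forall i, E i) (t : E i) : K^o := B (dfwith y i t).
have flin y : linear (f y) by exact: Blin.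
have fM y t : rnorm (f y t) <= M * \prod_(j <- S) rnorm (y j) * rnorm t.
  apply: le_trans (BM _) _.
  by rewrite big_cons dfwithin prod_rnorm_dfwith// mulrCA mulrC.
have prod0 y : 0 <= \prod_(j <- S) rnorm (y j : E j).
  by apply: prodr_ge0 => j _; exact: rnorm_ge0.
have fsum y : \sum_(l < N) rnorm (f y (x i l)) <= M * \prod_(j <- S) rnorm (y j) * m i.
  by apply: (linear_le_dual (xm _ iiS)) => //; exact: mulr_ge0.
(* With one coordinate left, weak summability alone gives the bound. *)
rewrite big_cons mulrA; have [S0|S0] := eqVneq S [::].
  have fE (j : 'I_N) : rnorm (B (fun i => x i j)) = rnorm (f (fun=> 0) (x i j)).
    congr rnorm; apply: Bdep => l; rewrite S0 inE => /eqP ->.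
    by rewrite dfwithin.
  have := fsum (fun=> 0); rewrite S0 !big_nil !mulr1.
  by apply: le_trans; apply: ler_sum => j _; rewrite fE.
have [c c1 cE] := phase_seq (fun j => B (fun i => x i j)).
(* Coordinate i is taken at index l and the others at index j; on the diagonal the phases turn each
   term into a modulus. *)
pose D l j : K^o := c l * f (fun i => x i j) (x i l).
have -> : \sum_(j < N) rnorm (B (fun i => x i j)) = rnorm (\sum_(j < N) D j j + 0).
  rewrite addr0 (_ : \sum_(j < N) D j j = of_real k (\sum_(j < N) rnorm (B (fun i => x i j)))).
    by rewrite rnorm_of_real ger0_norm// sumr_ge0// => j _; exact: rnorm_ge0.
  rewrite of_real_sum; apply: eq_bigr => j _; rewrite -cE /D /f; congr (_ * B _).
  exact: (dfwith_self (fun i => x i j)).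
apply: diagonal_le_signs => r r1.
have rn j : rnorm (r j : K^o) = 1.
  by case: (r1 j) => ->; rewrite ?rnormN rnorm1.
pose u := \sum_(l < N) (r l * c l) *: x i l.
have fu y : f y u = \sum_(l < N) (r l * c l) * f y (x i l).
  by rewrite linear_fun_sum//; apply: eq_bigr => l _; rewrite linear_funZ.
(* With coordinate i frozen at [u], [B] becomes a form in the remaining coordinates with constant
   [M * m i], whatever the signs. *)
have fuM y : rnorm (f y u) <= M * m i * \prod_(j <- S) rnorm (y j).
  rewrite fu mulrAC; apply: le_trans (fsum y); apply: le_trans (rnorm_sum _ _ _) _.
  apply: ler_sum => l _; rewrite !rnormM rn mul1r.
  by rewrite ler_piMl ?rnorm_ge0.
rewrite addr0 (_ : \sum_(j < N) _ = \sum_(j < N) r j * f (fun i => x i j) u); last first.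
  apply: eq_bigr => j _; rewrite fu mulr_sumr; apply: eq_bigr => l _.
  by rewrite /D !mulrA.
apply: le_trans (rnorm_sum _ _ _) _.
rewrite (eq_bigr (fun j : 'I_N => rnorm (f (fun i => x i j) u))); last first.
  by move=> j _; rewrite rnormM rn mul1r.
apply: (IH (fun y => f y u)) => //.
- by rewrite mulr_ge0// m0.
- move=> j jS y a s t; rewrite /f.
  have ji : j != i by apply: contraNneq iS => <-.
  by rewrite !(dfwithC _ _ _ ji); apply: Blin; rewrite inE jS orbT.
- move=> y z yz; apply: Bdep => j; rewrite inE => /orP[/eqP ->|jS].
    by rewrite !dfwithin.
  have ij : i != j by apply: contraNneq iS => ->.
  by rewrite !dfwithout// yz.
- by move=> j jS; apply: m0; rewrite inE jS orbT.
- by move=> j jS; apply: xm; rewrite inE jS orbT.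
Qed.

End DefantVoigt.

(** * Boundedness of continuous multilinear forms *)

Section MultilinearNorm.
Context (R : realType) (k : base_field).
Local Notation K := (scalars R k).
Variables (n : nat) (E : 'I_n -> completeNormedModType K).
Implicit Types (A : (forall i, E i) -> K^o) (x y : forall i, E i).

Lemma prod_topology_cvg0 (u : nat -> forall i, E i) :
  (forall i, u j i @[j --> \oo] --> (0 : E i)) ->
  (u : nat -> prod_topology E) @ \oo --> ((fun=> 0) : prod_topology E).
Proof.
move=> u0; apply/cvg_sup => i B /= [_ [[C oC <-] C0] sCB].
apply: (@filterS _ (u @ \oo) _ _ _ sCB); apply: (u0 i).
by apply: open_nbhs_nbhs; split.
Qed.

Lemma multilinear_scale A (a : 'I_n -> K) x : multilinear A ->
  A (fun i => a i *: x i) = (\prod_i a i) * A x.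
Proof.
move=> lA; pose z (S : seq 'I_n) := fun i => if i \in S then a i *: x i else x i.
have key S : uniq S -> A (z S) = (\prod_(i <- S) a i) * A x.
  elim: S => [_|i S IH /= /andP[iS /IH {}IH]]; first by rewrite big_nil mul1r.
  rewrite big_cons -mulrA -IH.
  have -> : z (i :: S) = dfwith (z S) i (a i *: x i).
    apply: functional_extensionality_dep => j; have [<-|ij] := eqVneq i j.
      by rewrite dfwithin /z mem_head.
    by rewrite dfwithout// /z inE eq_sym (negbTE ij).
  rewrite (linear_funZ _ _ (lA (z S) i)); congr (_ * A _).
  have -> : x i = z S i by rewrite /z (negbTE iS).
  exact: dfwith_self.
rewrite -(key _ (index_enum_uniq _)); congr (A _).
by apply: functional_extensionality_dep => i; rewrite /z mem_index_enum.
Qed.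

Lemma multilinear0 A x i : multilinear A -> x i = 0 -> A x = 0.
Proof.
move=> lA xi; rewrite -(dfwith_self x i) xi.
exact: (linear_fun0 (lA x i)).
Qed.

(** Otherwise some x_j in the unit balls have |A(x_j)| > (j+1)^n. Dividing all n coordinates by j+1
    gives points that tend to 0 with values above 1, against continuity at 0. *)
Lemma continuous_multilinear_bounded A : (0 < n)%N -> continuous_multilinear E K^o A ->
  exists M : R, forall x, (forall i, rnorm (x i) <= 1) -> rnorm (A x) <= M.
Proof.
move=> n0 [lA cA]; apply: contrapT => H.
have /choice[x xP] (j : nat) : exists x, (forall i, rnorm (x i) <= 1) /\
    j.+1%:R ^+ n < rnorm (A x).
  apply: contrapT => H'; apply: H; exists (j.+1%:R ^+ n) => x x1.
  by rewrite leNgt; apply/negP => h; apply: H'; exists x.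
pose a (j : nat) : K := of_real k j.+1%:R^-1.
have na (j : nat) : rnorm (a j : K^o) = j.+1%:R^-1.
  by rewrite rnorm_of_real ger0_norm.
pose u (j : nat) : forall i, E i := fun i => a j *: x j i.
have u0 : (u : nat -> prod_topology E) @ \oo --> ((fun=> 0) : prod_topology E).
  apply: prod_topology_cvg0 => i; apply/cvgrPdist_le => e e0.
  have [e'0 e'E] := real_of_gt0 e0.
  near=> j; rewrite sub0r normrN -rnormE.
  rewrite -e'E ler_of_real rnormZ na.
  apply: (@le_trans _ _ j.+1%:R^-1).
    by rewrite ler_piMr//; have [] := xP j.
  by apply: ltW; near: j; apply: (near_infty_natSinv_lt (PosNum e'0)).
have /cvgrPdist_lt : (A \o u) @ \oo --> A (fun=> 0).
  exact: (@cvg_comp _ _ _ u A _ _ _ u0 (cA (fun=> 0))).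
move=> /(_ 1 ltr01)[N _ /(_ N (leqnn N))] /=.
rewrite (@multilinear0 A (fun=> 0) (Ordinal n0))// sub0r normrN.
rewrite (multilinear_scale (fun=> a N))// -rnormE -[X in _ < X](of_real1 R k).
apply/negP; rewrite lt_neqAle ler_of_real negb_and -ltNge; apply/orP; right.
rewrite rnormM rnorm_prod (eq_bigr (fun=> N.+1%:R^-1))//.
rewrite prodr_const card_ord exprVn -ltr_pdivrMl ?invr_gt0 ?exprn_gt0// invrK mulr1.
by have [] := xP N.
Unshelve. all: by end_near. Qed.

Lemma multilinear_norm_fin A : (0 < n)%N -> continuous_multilinear E K^o A ->
  exists M : R, [/\ 0 <= M, multilinear_norm A = M%:E &
    forall x, rnorm (A x) <= M * \prod_i rnorm (x i)].
Proof.
move=> n0 cmA; have [M0 AM0] := continuous_multilinear_bounded n0 cmA.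
have [lA cA] := cmA.
have [M ME M_ge0] : exists2 M : R, multilinear_norm A = M%:E & 0 <= M.
  have : (multilinear_norm A <= M0%:E)%E.
    by apply: ge_ereal_sup => _ [x x1 <-]; rewrite lee_fin AM0.
  have : (0 <= multilinear_norm A)%E.
    apply: (@le_trans _ _ (rnorm (A (fun=> 0)))%:E); first by rewrite lee_fin rnorm_ge0.
    by apply: ereal_sup_ubound; exists (fun=> 0) => // i; rewrite rnorm0.
  by case: (multilinear_norm A) => // r r0 _; exists r.
exists M; split => // x.
have [[i /eqP xi]|x0] := pselect (exists i, x i == 0).
  by rewrite (multilinear0 lA xi) rnorm0 mulr_ge0// prodr_ge0// => j _; exact: rnorm_ge0.
have nx0 i : 0 < rnorm (x i).
  rewrite lt_neqAle rnorm_ge0 andbT eq_sym; apply/negP => /eqP/rnorm_eq0 xi.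
  by apply: x0; exists i; rewrite xi.
have P0 : 0 < \prod_i rnorm (x i) by apply: prodr_gt0.
have : ((rnorm (A (fun i => of_real k (rnorm (x i))^-1 *: x i)))%:E <= multilinear_norm A)%E.
  apply: ereal_sup_ubound; exists (fun i => of_real k (rnorm (x i))^-1 *: x i) => // i.
  by rewrite rnormZ rnorm_of_real gtr0_norm ?invr_gt0// mulVf ?gt_eqF.
rewrite ME lee_fin multilinear_scale// rnormM rnorm_prod.
rewrite (eq_bigr (fun i => (rnorm (x i))^-1)); last first.
  by move=> i _; rewrite rnorm_of_real gtr0_norm ?invr_gt0.
by rewrite prodfV ler_pdivrMl// mulrC.
Qed.

End MultilinearNorm.

(** * Pairing with the projective tensor product *)

Section Pairing.
Context (R : realType) (k : base_field).
Local Notation K := (scalars R k).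

Lemma cauchy_schwarz_le N (a b : nat -> R) (al be : R) : 0 <= al -> 0 <= be ->
  (forall j, 0 <= a j) -> (forall j, 0 <= b j) ->
  \sum_(j < N) a j ^+ 2 <= al ^+ 2 -> \sum_(j < N) b j ^+ 2 <= be ^+ 2 ->
  \sum_(j < N) a j * b j <= al * be.
Proof.
move=> al0 be0 a0 b0 sa sb.
have zero (c : nat -> R) (j : 'I_N) : (forall j, 0 <= c j) ->
    \sum_(j < N) c j ^+ 2 <= 0 -> c j = 0.
  move=> c0 s0; apply/eqP; rewrite -sqrf_eq0 eq_le sqr_ge0 andbT (le_trans _ s0)//.
  by rewrite (bigD1 j)//= lerDl sumr_ge0// => i _; exact: sqr_ge0.
have [al_eq0|aln0] := eqVneq al 0.
  rewrite al_eq0 mul0r big1// => j _; rewrite (zero a)// ?mul0r//.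
  by rewrite (le_trans sa)// al_eq0 expr0n.
have [be_eq0|ben0] := eqVneq be 0.
  rewrite be_eq0 mulr0 big1// => j _; rewrite (zero b) ?mulr0//.
  by rewrite (le_trans sb)// be_eq0 expr0n.
have alp : 0 < al by rewrite lt_neqAle eq_sym aln0.
have bep : 0 < be by rewrite lt_neqAle eq_sym ben0.
(* The ratio be/al balances the arithmetic-geometric inequality so that each half contributes at
   most al be / 2. *)
apply: (@le_trans _ _ (\sum_(j < N) (be / al / 2 * a j ^+ 2 + al / be / 2 * b j ^+ 2))).
  apply: ler_sum => j _; rewrite -subr_ge0.
  have -> : be / al / 2 * a j ^+ 2 + al / be / 2 * b j ^+ 2 - a j * b j =
    (be * a j - al * b j) ^+ 2 / (2 * al * be) by field; rewrite ben0 aln0.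
  by rewrite divr_ge0 ?sqr_ge0// !mulr_ge0.
rewrite big_split/= -!mulr_sumr.
have -> : al * be = be / al / 2 * al ^+ 2 + al / be / 2 * be ^+ 2.
  by field; rewrite ben0 aln0.
by apply: lerD; apply: ler_wpM2l => //; rewrite !divr_ge0.
Qed.

Lemma sum_finite_support (g : nat -> R) N N' : (forall j, 0 <= g j) ->
  (forall j, (N <= j)%N -> g j = 0) -> \sum_(j < N') g j <= \sum_(j < N) g j.
Proof.
move=> g0 gN; rewrite -!(big_mkord xpredT g).
have [NN'|/ltnW NN'] := leqP N N'.
  rewrite (big_cat_nat (leq0n N) NN')//=.
  have -> : \sum_(N <= j < N') g j = 0 by rewrite big_nat big1// => j /andP[/gN].
  by rewrite addr0.
by rewrite [leRHS](big_cat_nat (leq0n N') NN')//= lerDl sumr_ge0.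
Qed.

Lemma lp_norm_finite_support (F : normedModType K) (p : \bar R) (y : nat -> F) N :
  (1 <= p)%E -> (forall j, (N <= j)%N -> y j = 0) ->
  (lp_norm p y <= (\sum_(j < N) rnorm (y j))%:E)%E.
Proof.
move=> p1 yN; apply: lp_norm_le_weighted => //.
  by apply: sumr_ge0 => j _; exact: rnorm_ge0.
move=> N' b bN'; apply: (@le_trans _ _ (\sum_(j < N') rnorm (y j))).
  apply: ler_sum => j _; rewrite ler_piMl ?rnorm_ge0// powR_le1//.
    by rewrite (weights_le1 j bN') andbT; case: bN'.
  by rewrite subr_ge0; have /andP[] := fine_inve_itv p1.
apply: (@sum_finite_support (fun j => rnorm (y j))) => [j|j /yN ->].
  exact: rnorm_ge0.
exact: rnorm0.
Qed.

Variable E : normedModType K.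

Lemma l2_proj_norm_finite (u : nat -> E) N : (forall j, (N <= j)%N -> u j = 0) ->
  l2_proj_norm u = proj_norm u.
Proof.
move=> uN; apply: lim_near_cst => //; exists N => // N' /= NN'; congr proj_norm.
apply/funext => j; rewrite /tensor_section; case: ltnP => // N'j.
by rewrite uN// (leq_trans NN').
Qed.

End Pairing.

(** Along a representation of u as a finite sum of a_i (x) y_i, the pairing is the double sum of
    a_i(j) y_i(x_j). Cauchy-Schwarz in j bounds it by mu times the cost of the representation, and
    that cost comes within any e of the infimum. *)
Lemma pairing_le (R : realType) (k : base_field) (E : normedModType (scalars R k))
    (u : nat -> dual E) (x : nat -> E) N (mu T : R) :
  0 <= mu ->
  (forall g : dual E, rnorm g <= 1 ->
    \sum_(j < N) rnorm (g (x j)) ^+ 2 <= mu ^+ 2) ->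
  (proj_norm u <= T%:E)%E -> rnorm (\sum_(j < N) u j (x j)) <= T * mu.
Proof.
move=> mu0 xmu uT.
have xg (g : dual E) : \sum_(j < N) rnorm (g (x j)) ^+ 2 <= (rnorm g * mu) ^+ 2.
  have [->|g0] := eqVneq g 0.
    rewrite big1 ?sqr_ge0// => j _.
    by rewrite (_ : (0 : dual E) (x j) = 0)// rnorm0 expr0n.
  have ng0 : 0 < rnorm g.
    by rewrite lt_neqAle rnorm_ge0 andbT eq_sym; apply: contra_neq g0; exact: rnorm_eq0.
  have : rnorm (of_real k (rnorm g)^-1 *: g) <= 1.
    by rewrite rnormZ rnorm_of_real gtr0_norm ?invr_gt0// mulVf ?gt_eqF.
  move=> /xmu h; rewrite exprMn -ler_pdivrMl ?exprn_gt0// mulr_sumr; apply: le_trans h.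
  apply: ler_sum => j _.
  rewrite (_ : (of_real k (rnorm g)^-1 *: g) (x j) = of_real k (rnorm g)^-1 *: g (x j))//.
  by rewrite rnormZ rnorm_of_real gtr0_norm ?invr_gt0// exprMn exprVn.
have [mu_eq0|mun0] := eqVneq mu 0.
  rewrite big1 ?rnorm0 ?mu_eq0 ?mulr0// => j _; apply: rnorm_eq0; apply/eqP.
  rewrite -sqrf_eq0 eq_le sqr_ge0 andbT.
  have := xg (u j); rewrite mu_eq0 mulr0 expr0n; apply: le_trans.
  by rewrite (bigD1 j)//= lerDl sumr_ge0// => i _; exact: sqr_ge0.
have mup : 0 < mu by rewrite lt_neqAle eq_sym mun0.
rewrite -ler_pdivrMr//; apply/ler_addgt0Pr => e e0.
have : (proj_norm u < (T + e)%:E)%E by rewrite (le_lt_trans uT)// lte_fin ltrDl.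
move=> /ereal_inf_lt[_ [m [a [y [al uE ->]]]]] tT.
have /choice[al' al'P] i : exists r : R, 0 <= r /\ lp_norm 2%:E (a i) = r%:E.
  by have [r r0 rE] := lp_normE (al i); exists r.
have {}tT : \sum_(i < m) al' i * rnorm (y i) <= T + e.
  rewrite -lee_fin -sumEFin (le_trans _ (ltW tT))// le_eqVlt; apply/orP; left; apply/eqP.
  by apply: eq_bigr => i _; rewrite (al'P i).2 EFinM.
apply: le_trans tT; rewrite ler_pdivrMr// mulr_suml.
rewrite (_ : \sum_(j < N) _ = \sum_(i < m) \sum_(j < N) a i j * y i (x j)); last first.
  rewrite exchange_big/=; apply: eq_bigr => j _.
  by rewrite uE dual_sumE.
apply: le_trans (rnorm_sum _ _ _) _; apply: ler_sum => i _.
apply: le_trans (rnorm_sum _ _ _) _.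
rewrite (eq_bigr (fun j : 'I_N => rnorm (a i j) * rnorm (y i (x j)))); last first.
  by move=> j _; rewrite rnormM.
rewrite -mulrA; have [al0 alE] := al'P i.
apply: (@cauchy_schwarz_le R N (fun j => rnorm (a i j)) (fun j => rnorm (y i (x j)))) => //.
- by rewrite mulr_ge0// rnorm_ge0.
- by move=> j; exact: rnorm_ge0.
- by move=> j; exact: rnorm_ge0.
have := @Lnorm_fin_leP R 2 (al' i) (fun j => rnorm (a i j)) _ al0 (fun j => rnorm_ge0 _).
move=> /(_ (ler1n _ _))[+ _].
rewrite -[X in (X <= _)%E]/(lp_norm 2%:E (a i)) alE => /(_ (lexx _) N).
rewrite powR_mulrn//; congr (_ <= _); apply: eq_bigr => j _.
by rewrite powR_mulrn// rnorm_ge0.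
Qed.

(** * The reduced case: exponents 1, ..., 1, 2 and p = 1 *)

Section SummingCore.
Context (R : realType) (k : base_field).
Local Notation K := (scalars R k).
Variables (n : nat) (E : 'I_n -> completeNormedModType K) (last : 'I_n).
Variables (A : (forall i, E i) -> K^o) (M : R).
Hypotheses (n2 : (2 <= n)%N) (lA : multilinear A) (M0 : 0 <= M)
  (AM : forall x, rnorm (A x) <= M * \prod_i rnorm (x i)).

Let S := [seq i <- index_enum 'I_n | i != last].

Let mem_S i : (i \in S) = (i != last).
Proof. by rewrite mem_filter mem_index_enum andbT. Qed.

Let prod_S (m : 'I_n -> R) : \prod_i m i = \prod_(i <- S) m i * m last.
Proof. by rewrite (bigD1 last)//= mulrC big_filter. Qed.

Let S_neq0 : S != [::].
Proof.
have [i il] : exists i : 'I_n, i != last.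
  have n1 : (1 < n)%N by [].
  have [l0|l0] := eqVneq (last : nat) 0%N.
    by exists (Ordinal n1); rewrite -val_eqE/= l0.
  by exists (Ordinal (ltnW n1)); rewrite -val_eqE/= eq_sym.
by apply/eqP => S0; move: il; rewrite -mem_S S0.
Qed.

Lemma curry_last (x : forall i, E i) : exists2 g : dual (E last),
  forall t, g t = A (dfwith x last t) & rnorm g <= M * \prod_(i <- S) rnorm (x i).
Proof.
have P0 : 0 <= M * \prod_(i <- S) rnorm (x i).
  by rewrite mulr_ge0// prodr_ge0// => i _; exact: rnorm_ge0.
have [|g gE gM] := @mkdual R k (E last) (fun t => A (dfwith x last t)) _ (@lA x last) P0.
  move=> t; apply: le_trans (AM _) _; rewrite prod_S dfwithin mulrA.
  by rewrite prod_rnorm_dfwith// mem_S eqxx.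
by exists g => // t; rewrite gE.
Qed.

Variable C : R.
Hypotheses (C0 : 0 <= C) (LO : littlewood_orlicz_with (dual (E last)) C).

Lemma summing_core N (z : forall i, nat -> E i) (m : 'I_n -> R) :
  (forall i, 0 <= m i) ->
  (forall i, i != last -> forall g : dual (E i), rnorm g <= 1 ->
    \sum_(j < N) rnorm (g (z i j)) <= m i) ->
  (forall g : dual (E last), rnorm g <= 1 ->
    \sum_(j < N) rnorm (g (z last j)) ^+ 2 <= m last ^+ 2) ->
  \sum_(j < N) rnorm (A (fun i => z i j)) <= C * M * \prod_i m i.
Proof.
move=> m0 zm zm2.
have /choice[G GP] x : exists g : dual (E last),
    (forall t, g t = A (dfwith x last t)) /\ rnorm g <= M * \prod_(i <- S) rnorm (x i).
  by have [g] := curry_last x; exists g.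
have GE x t : G x t = A (dfwith x last t) by have [] := GP x.
have GM x : rnorm (G x) <= M * \prod_(i <- S) rnorm (x i) by have [] := GP x.
(* [G] comes from choice, but its values determine a functional, so [G x] ignores the last
   coordinate of [x]. *)
have Geq x y : (forall i, i \in S -> x i = y i) -> G x = G y.
  move=> xy; apply: dual_ext => t; rewrite !GE; congr A.
  apply: functional_extensionality_dep => i; have [<-|li] := eqVneq last i.
    by rewrite !dfwithin.
  by rewrite !dfwithout// xy// mem_S eq_sym.
have [c c1 cE] := phase_seq (fun j => A (fun i => z i j)).
(* The phases make the pairing of [v] with [z last] a sum of moduli; the truncation at N lets its
   norm in the completion be computed without a limit. *)
pose v (j : nat) : dual (E last) := if (j < N)%N then c j *: G (fun i => z i j) else 0.
have vN j : (N <= j)%N -> v j = 0 by rewrite /v ltnNge => ->.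
have P0 : 0 <= M * \prod_(i <- S) m i by rewrite mulr_ge0// prodr_ge0.
(* [Phi] composed with [G] is multilinear in the coordinates other than the last, so the
   Defant-Voigt bound applies to it. *)
have v_weak (Phi : dual (dual (E last))) :
    (lp_norm 1 (fun j => Phi (v j)) <= (rnorm Phi * (M * \prod_(i <- S) m i))%:E)%E.
  apply: le_trans (lp_norm_finite_support (N := N) _ _) _ => //.
    by move=> j Nj; rewrite vN// dual_fun0.
  rewrite lee_fin.
  have := @defant_voigt R k n E S (fun x => Phi (G x)) (rnorm Phi * M) N z m S_neq0.
  rewrite mulrA => h; apply: le_trans (h _ _ _ _ _ _ _).
  - apply: ler_sum => j _; rewrite /v ltn_ord dual_funZ rnormZ.
    by rewrite ler_piMl// rnorm_ge0.
  - by rewrite filter_uniq// index_enum_uniq.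
  - by rewrite mulr_ge0// rnorm_ge0.
  - move=> i; rewrite mem_S => il y a s t.
    have -> : G (dfwith y i (a *: s + t)) = a *: G (dfwith y i s) + G (dfwith y i t).
      apply: dual_ext => w; rewrite dual_funE !GE !(dfwithC _ _ _ il).
      exact: lA.
    exact: dual_linear.
  - by move=> x y xy; rewrite (Geq _ _ xy).
  - move=> y; apply: le_trans (dual_le _ _) _; rewrite -mulrA.
    by rewrite ler_wpM2l ?rnorm_ge0.
  - by move=> i _; exact: m0.
  - by move=> i; rewrite mem_S; exact: zm.
have v_proj : (proj_norm v <= (C * (M * \prod_(i <- S) m i))%:E)%E.
  rewrite -(l2_proj_norm_finite vN).
  have [|_] := LO (x := v).
    by move=> Phi; rewrite /lp/= (le_lt_trans (v_weak Phi))// ltry.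
  move=> /le_trans; apply; rewrite EFinM lee_wpmul2l ?lee_fin//.
  apply/weak_lp_norm_le => Phi Phi1; apply: le_trans (v_weak Phi) _.
  by rewrite lee_fin ler_piMl.
have := pairing_le (m0 last) zm2 v_proj.
rewrite prod_S !mulrA; apply: le_trans.
rewrite (_ : \sum_(j < N) v j (z last j) =
    of_real k (\sum_(j < N) rnorm (A (fun i => z i j)))).
  by rewrite rnorm_of_real ler_norm.
rewrite of_real_sum; apply: eq_bigr => j _; rewrite /v ltn_ord -cE.
rewrite (_ : (c j *: G (fun i => z i j)) (z last j) = c j * G (fun i => z i j) (z last j))//.
by rewrite GE (dfwith_self (fun i => z i j)).
Qed.

End SummingCore.

(** * The summing bound *)

Section Exponents.
Context (R : realType).

Lemma inve_ge1_fin (q : \bar R) : (1 <= q)%E -> (q^-1)%E = (fine (q^-1)%E)%:E.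
Proof.
move: q => [r| |]//=; rewrite lee_fin => r1.
by rewrite inver gt_eqF ?(lt_le_trans ltr01).
Qed.

(** Each 1/p_i is at most 1 and the last at most 1/2, so their sum is at most n - 1/2 and the
    condition leaves 1/p <= 1. All inverses being finite, what remains is real arithmetic. *)
Lemma summing_exponents (n : nat) (last : 'I_n) (ps : 'I_n -> \bar R) (p : \bar R) :
  (forall i, (1 <= ps i)%E) -> (2%:E <= ps last)%E -> (0 < p)%E ->
  ((n%:R - 3 / 2)%:E <= \sum_(i < n) (ps i)^-1 - p^-1)%E ->
  [/\ (1 <= p)%E, fine (ps last)^-1 <= 2^-1 &
    n%:R - 3 / 2 <= \sum_(i < n) fine (ps i)^-1 - fine p^-1].
Proof.
move=> ps1 pl p0; rewrite (eq_bigr (fun i => (fine (ps i)^-1)%:E)); last first.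
  by move=> i _; rewrite -inve_ge1_fin.
rewrite sumEFin.
have pl2 : fine (ps last)^-1 <= 2^-1.
  move: pl; case: (ps last) => [r| |]//=.
  rewrite lee_fin => r2; have r0 : 0 < r by rewrite (lt_le_trans _ r2).
  by rewrite inver gt_eqF//= lef_pV2// posrE.
have p_fin : (p^-1)%E = (fine (p^-1)%E)%:E.
  by move: p p0 => [r| |]//=; rewrite lte_fin => r0; rewrite inver gt_eqF.
rewrite p_fin -EFinB lee_fin /= => h; split => //.
have : fine p^-1 <= 1.
  have : \sum_(i < n) fine (ps i)^-1 <= n%:R - 2^-1.
    rewrite (bigD1 last)//= (le_trans (lerD pl2 (lexx _)))//.
    apply: (@le_trans _ _ (2^-1 + \sum_(i < n | i != last) 1)).
      by rewrite lerD2l ler_sum// => i _; have /andP[] := fine_inve_itv (ps1 i).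
    have -> : \sum_(i < n | i != last) 1 = n%:R - 1 :> R.
      have : \sum_(i < n) 1 = n%:R :> R by rewrite sumr_const card_ord.
      by rewrite (bigD1 last)//= => <-; rewrite addrAC subrr add0r.
    lra.
  move: h; lra.
move: p p0 {p_fin h} => [r| |]//=; last by rewrite leey.
by rewrite lte_fin => r0; rewrite inver gt_eqF//= lee_fin invf_le1.
Qed.

End Exponents.

Section SummingBound.
Context (R : realType) (k : base_field).
Local Notation K := (scalars R k).

Lemma littlewood_orlicz_le (F : normedModType K) (C C' : R) : C <= C' ->
  littlewood_orlicz_with F C -> littlewood_orlicz_with F C'.
Proof.
move=> CC' LO x /LO[h1 h2]; split => //; apply: le_trans h2 _.
by apply: lee_wpmul2r; rewrite ?lee_fin//; exact: weak_lp_norm_ge0.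
Qed.

(** A negative constant makes the projective norm of (f, 0, 0, ...) nonpositive, and pairing with
    the constant sequence t then gives f(t) = 0. *)
Lemma littlewood_orlicz_lt0 (F : normedModType K) (C : R) : C < 0 ->
  littlewood_orlicz_with (dual F) C -> forall (f : dual F) t, f t = 0.
Proof.
move=> C0 LO f t; pose v (j : nat) := if j is 0%N then f else 0.
have vN j : (1 <= j)%N -> v j = 0 by case: j.
have [|_] := LO v.
  move=> Phi; rewrite /lp/=.
  have h : (lp_norm 1 (fun j => Phi (v j)) <= (\sum_(j < 1) rnorm (Phi (v j)))%:E)%E.
    by apply: lp_norm_finite_support => // j /vN ->; rewrite dual_fun0.
  by rewrite (le_lt_trans h)// ltry.
rewrite (l2_proj_norm_finite vN) => v_proj.
have {}v_proj : (proj_norm v <= 0%:E)%E.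
  apply: le_trans v_proj _; rewrite mule_le0_ge0 ?lee_fin ?(ltW C0)//.
  exact: weak_lp_norm_ge0.
apply: rnorm_eq0; apply/eqP; rewrite eq_le rnorm_ge0 andbT.
have := @pairing_le R k F v (fun=> t) 1 (rnorm t) 0 (rnorm_ge0 t) _ v_proj.
rewrite !big_ord1 mul0r; apply => g g1; rewrite big_ord1 lerXn2r ?nnegrE ?rnorm_ge0//.
by rewrite (le_trans (dual_le g t))// ler_piMl// rnorm_ge0.
Qed.

Variables (n : nat) (E : 'I_n -> completeNormedModType K) (last : 'I_n).
Variables (ps : 'I_n -> \bar R) (p : \bar R).
Hypotheses (n2 : (2 <= n)%N) (ps1 : forall i, (1 <= ps i)%E) (pl : (2%:E <= ps last)%E)
  (p0 : (0 < p)%E) (hp : ((n%:R - 3 / 2)%:E <= \sum_(i < n) (ps i)^-1 - p^-1)%E).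
Variables (A : (forall i, E i) -> K^o) (M C : R).
Hypotheses (lA : multilinear A) (M0 : 0 <= M)
  (AM : forall x, rnorm (A x) <= M * \prod_i rnorm (x i)).
Hypotheses (C0 : 0 <= C) (LO : littlewood_orlicz_with (dual (E last)) C).

(* The weight [b_j] is distributed over the factors: [x^i] is multiplied by
   [b_j^(d_i)], which turns a weakly [p_i]-summable sequence into a weakly
   1-summable one, or a weakly 2-summable one if [i] is the last index. *)
Lemma weighted_summing (x : forall i, nat -> E i) (m : 'I_n -> R) N b :
  (forall i, 0 <= m i) -> (forall i, (weak_lp_norm (ps i) (x i) <= (m i)%:E)%E) ->
  weights N b ->
  \sum_(j < N) b j `^ (1 - fine p^-1) * rnorm (A (fun i => x i j)) <=
    C * M * \prod_i m i.
Proof.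
move=> m0 xm bN; have [p1 pl2 hp'] := summing_exponents ps1 pl p0 hp.
pose d i : R := (if i == last then 2^-1 else 1) - fine (ps i)^-1.
have d0 i : 0 <= d i.
  rewrite /d subr_ge0; case: eqVneq => [->//|_].
  by have /andP[] := fine_inve_itv (ps1 i).
(* The d_i sum to n - 1/2 minus the sum of the 1/p_i; the condition on the exponents says exactly
   that this is at most 1 - 1/p. *)
have sd : \sum_i d i <= 1 - fine p^-1.
  rewrite /d sumrB.
  have -> : \sum_i (if i == last then 2^-1 else 1) = n%:R - 2^-1 :> R.
    have : \sum_(i < n) 1 = n%:R :> R by rewrite sumr_const card_ord.
    rewrite (bigD1 last)//= => <-; rewrite (bigD1 last)//= eqxx.
    rewrite (eq_bigr (fun=> 1)); first lra.
    by move=> i /negbTE ->.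
  lra.
pose z i j := of_real k (b j `^ d i) *: x i j.
have [b0 _] := bN.
have nz i j (g : dual (E i)) : rnorm (g (z i j)) = b j `^ d i * rnorm (g (x i j)).
  by rewrite dual_funZ rnormZ rnorm_of_real ger0_norm// powR_ge0.
apply: (@le_trans _ _ (\sum_(j < N) rnorm (A (fun i => z i j)))).
  apply: ler_sum => j _; rewrite /z (multilinear_scale _ _ lA) rnormM rnorm_prod.
  rewrite ler_wpM2r ?rnorm_ge0//.
  rewrite (eq_bigr (fun i => b j `^ d i)); last first.
    by move=> i _; rewrite rnorm_of_real ger0_norm// powR_ge0.
  by apply: powR_le_prod => //; rewrite b0 (weights_le1 j bN).
apply: (summing_core n2 lA M0 AM C0 LO) => // [i il g g1|g g1].
  rewrite (eq_bigr (fun j : 'I_N => b j `^ d i * rnorm (g (x i j)))); last first.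
    by move=> j _; rewrite nz.
  rewrite /d (negbTE il).
  have gxm := (weak_lp_norm_le (ps i) (x i) _).1 (xm i) g g1.
  exact: (lp_norm_weighted (ps1 i) (m0 i) gxm bN).
rewrite (eq_bigr (fun j : 'I_N => b j `^ (1 - 2%:R * fine (ps last)^-1) *
    rnorm (g (x last j)) ^+ 2)); last first.
  move=> j _; rewrite nz exprMn; congr (_ * _).
  rewrite -(powR_mulrn 2 (powR_ge0 _ _)) -powRrM /d eqxx.
  by congr (_ `^ _); lra.
apply: (@weighted_sum_le R (ps last) (fun j => rnorm (g (x last j)))) => //.
  by move=> j; exact: rnorm_ge0.
exact: ((weak_lp_norm_le (ps last) (x last) _).1 (xm last) g g1).
Qed.

Lemma lp_norm_hat_le (x : forall i, nat -> E i) (m : 'I_n -> R) :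
  (forall i, 0 <= m i) -> (forall i, (weak_lp_norm (ps i) (x i) <= (m i)%:E)%E) ->
  (lp_norm p (hat A x) <= (C * M * \prod_i m i)%:E)%E.
Proof.
move=> m0 xm; have [p1 _ _] := summing_exponents ps1 pl p0 hp.
apply: lp_norm_le_weighted => //; first by rewrite !mulr_ge0// prodr_ge0.
by move=> N b bN; exact: weighted_summing.
Qed.

End SummingBound.

(** * Continuity of the induced map *)

Section Continuity.
Context (R : realType) (k : base_field).
Local Notation K := (scalars R k).

(** Minkowski's inequality by duality: in a weighted sum it is the triangle inequality term by
    term. *)
Lemma weak_lp_normD (F : normedModType K) (q : \bar R) (u v : nat -> F) (a b : R) :
  (1 <= q)%E -> 0 <= a -> 0 <= b ->
  (weak_lp_norm q u <= a%:E)%E -> (weak_lp_norm q v <= b%:E)%E ->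
  (weak_lp_norm q (fun j => u j + v j)%R <= (a + b)%:E)%E.
Proof.
move=> q1 a0 b0 ua vb; apply/weak_lp_norm_le => f f1.
apply: lp_norm_le_weighted => //; first exact: addr_ge0.
move=> N w wN.
have fu := lp_norm_weighted q1 a0 ((weak_lp_norm_le q u _).1 ua f f1) wN.
have fv := lp_norm_weighted q1 b0 ((weak_lp_norm_le q v _).1 vb f f1) wN.
apply: le_trans (lerD fu fv); rewrite -big_split/=; apply: ler_sum => j _.
rewrite -mulrDr ler_wpM2l ?powR_ge0//.
by rewrite (linear_funD _ _ (@dual_linear _ _ _ f)) rnormD.
Qed.

Variables (n : nat) (E : 'I_n -> completeNormedModType K) (last : 'I_n).
Variables (ps : 'I_n -> \bar R) (p : \bar R).
Hypotheses (n2 : (2 <= n)%N) (ps1 : forall i, (1 <= ps i)%E) (pl : (2%:E <= ps last)%E)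
  (p0 : (0 < p)%E) (hp : ((n%:R - 3 / 2)%:E <= \sum_(i < n) (ps i)^-1 - p^-1)%E).
Variables (A : (forall i, E i) -> K^o) (M C : R).
Hypotheses (lA : multilinear A) (M0 : 0 <= M)
  (AM : forall x, rnorm (A x) <= M * \prod_i rnorm (x i)).
Hypotheses (C0 : 0 <= C) (LO : littlewood_orlicz_with (dual (E last)) C).

(* Telescoping: the coordinates of [x] are replaced by those of [y] one by one. *)
Lemma lp_norm_hatB_le (x y : forall i, nat -> E i) (L d : R) : 1 <= L -> 0 <= d ->
  (forall i, (weak_lp_norm (ps i) (x i) <= L%:E)%E) ->
  (forall i, (weak_lp_norm (ps i) (y i) <= L%:E)%E) ->
  (forall i, (weak_lp_norm (ps i) (y i \- x i)%R <= d%:E)%E) ->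
  (lp_norm p (hat A y \- hat A x)%R <= (n%:R * (C * M * (d * L ^+ n)))%:E)%E.
Proof.
move=> L1 d0 xL yL yxd; have [p1 _ _] := summing_exponents ps1 pl p0 hp.
have L0 : 0 <= L by rewrite (le_trans ler01).
have T0 : 0 <= C * M * (d * L ^+ n) by rewrite !mulr_ge0// exprn_ge0.
apply: lp_norm_le_weighted => //; first exact: mulr_ge0.
move=> N b bN.
pose z (S : seq 'I_n) i j := if i \in S then y i j else x i j.
have key S : uniq S -> \sum_(j < N) b j `^ (1 - fine p^-1) *
    rnorm (A (fun i => z S i j) - A (fun i => x i j)) <= (size S)%:R * (C * M * (d * L ^+ n)).
  elim: S => [_|i S IH /= /andP[iS /IH {}IH]].
    by rewrite mul0r big1// => j _; rewrite subrr rnorm0 mulr0.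
  (* By linearity in coordinate i, one replacement changes the value of [A] by its value at [h],
     whose norm is at most d in that coordinate and at most L in the others. *)
  pose h := dfwith (z S) i (y i \- x i) : forall i, nat -> E i.
  pose m l := if l == i then d else L.
  have hm l : (weak_lp_norm (ps l) (h l) <= (m l)%:E)%E.
    rewrite /m /h; have [->|li] := eqVneq l i; first by rewrite dfwithin.
    by rewrite dfwithout 1?eq_sym//; rewrite /z; case: (l \in S).
  have m0 l : 0 <= m l by rewrite /m; case: ifP.
  have AE j : A (fun l => z (i :: S) l j) - A (fun l => z S l j) = A (fun l => h l j).
    have dE (t : nat -> E i) l : dfwith (z S) i t l j = dfwith (fun l => z S l j) i (t j) l.
      have [<-|il] := eqVneq i l; first by rewrite !dfwithin.
      by rewrite !dfwithout.
    have -> : (fun l => h l j) = dfwith (fun l => z S l j) i (y i j - x i j).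
      by apply: functional_extensionality_dep => l; rewrite /h dE.
    have -> : (fun l => z (i :: S) l j) = dfwith (fun l => z S l j) i (y i j).
      apply: functional_extensionality_dep => l; have [<-|il] := eqVneq i l.
        by rewrite dfwithin /z mem_head.
      by rewrite dfwithout// /z inE eq_sym (negbTE il).
    rewrite -[in X in _ - A X](dfwith_self (fun l => z S l j) i).
    have -> : z S i j = x i j by rewrite /z (negbTE iS).
    have lAi := @lA (fun l => z S l j) i.
    rewrite (linear_funD _ _ lAi) -[in RHS](scaleN1r (x i j)).
    by rewrite (linear_funZ _ _ lAi) scaleN1r.
  have hb := weighted_summing n2 ps1 pl p0 hp lA M0 AM C0 LO m0 hm bN.
  rewrite -nat1r mulrDl mul1r.
  apply: le_trans (lerD (_ : _ <= C * M * (d * L ^+ n)) IH); last first.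
    apply: le_trans hb _; rewrite ler_wpM2l ?mulr_ge0//.
    rewrite (bigD1 i)//= {1}/m eqxx ler_wpM2l//.
    rewrite (eq_bigr (fun=> L)); last by move=> l /negbTE li; rewrite /m li.
    (* The other coordinates contribute a power of L, enlarged to L^n because 1 <= L. *)
    rewrite prodr_const; apply: ler_weXn2l => //.
    by rewrite -[leqRHS]card_ord max_card.
  rewrite -big_split/=; apply: ler_sum => j _.
  rewrite -mulrDr ler_wpM2l ?powR_ge0// -AE.
  by rewrite -[leLHS]/(rnorm _) -(subrKA (A (fun l => z S l j))) rnormD.
have := key (index_enum 'I_n) (index_enum_uniq _).
have -> : size (index_enum 'I_n) = n by rewrite -[RHS]card_ord cardT enumT.
apply: le_trans; apply: ler_sum => j _; rewrite ler_wpM2l ?powR_ge0//.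
rewrite /hat /=; have -> // : (fun i => z (index_enum 'I_n) i j) = (fun i => y i j).
by apply: functional_extensionality_dep => i; rewrite /z mem_index_enum.
Qed.

Lemma hat_boundedP : hat_bounded p ps A.
Proof.
have fin_norm x : weak_lp_prod ps x -> exists m : 'I_n -> R,
    (forall i, 0 <= m i) /\ forall i, (weak_lp_norm (ps i) (x i) <= (m i)%:E)%E.
  move=> xp; have /choice[m mP] i : exists r : R,
      0 <= r /\ (weak_lp_norm (ps i) (x i) <= r%:E)%E.
    by have [r r0 rE] := weak_lp_norm_fin (ps1 i) (xp i); exists r; rewrite rE.
  by exists m; split => i; have [] := mP i.
split=> [x /fin_norm[m [m0 xm]]|x /fin_norm[m [m0 xm]] e e0].
  have := lp_norm_hat_le n2 ps1 pl p0 hp lA M0 AM C0 LO m0 xm.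
  by move=> h; rewrite /lp/= (le_lt_trans h)// ltry.
(* Room for [x] and for every [y] within distance 1 of it in each coordinate. *)
pose L := 1 + \sum_i m i.
have sm0 : 0 <= \sum_i m i by rewrite sumr_ge0.
have L1 : 1 <= L by rewrite lerDl.
have mL i : m i + 1 <= L.
  by rewrite addrC lerD2l (bigD1 i)//= lerDl sumr_ge0.
pose T := n%:R * (C * M * L ^+ n).
have T0 : 0 <= T by rewrite !mulr_ge0// exprn_ge0// (le_trans ler01).
(* The minimum with 1 keeps [y] within the bound L; T + 1 replaces T, which may be 0. *)
pose d := Num.min 1 (e / (T + 1)).
have T1 : 0 < T + 1 by rewrite ltr_wpDl.
have d0 : 0 < d by rewrite lt_min ltr01 divr_gt0.
exists d => // y yp yxd.
have d1 : d <= 1 by rewrite ge_min lexx.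
have yL i : (weak_lp_norm (ps i) (y i) <= L%:E)%E.
  have -> : y i = (fun j => (y i \- x i) j + x i j).
    by apply/funext => j; rewrite /= subrK.
  apply: le_trans (weak_lp_normD (ps1 i) (ltW d0) (m0 i) (ltW (yxd i)) (xm i)) _.
  by rewrite lee_fin (le_trans _ (mL i))// addrC lerD2l.
have xL i : (weak_lp_norm (ps i) (x i) <= L%:E)%E.
  by rewrite (le_trans (xm i))// lee_fin (le_trans _ (mL i))// lerDl.
have h := lp_norm_hatB_le L1 (ltW d0) xL yL (fun i => ltW (yxd i)).
apply: le_lt_trans h _; rewrite lte_fin.
have -> : n%:R * (C * M * (d * L ^+ n)) = T * d by rewrite /T; ring.
apply: (@le_lt_trans _ _ (T * (e / (T + 1)))).
  by rewrite ler_wpM2l// ge_min lexx orbT.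
by rewrite mulrCA gtr_pMr// ltr_pdivrMr// mul1r ltrDl.
Qed.

End Continuity.

Theorem theorem4p1 (R : realType) (k : base_field) (n : nat) (hn : (2 <= n)%N)
    (last : 'I_n) (hlast : last.+1 = n)
    (ps : 'I_n -> \bar R) (hps : forall i, (1 <= ps i)%E)
    (hpn : (2%:E <= ps last)%E)
    (hsum : ((n%:R - 3 / 2)%:E <= \sum_(i < n) (ps i)^-1)%E)
    (E : 'I_n -> completeNormedModType (scalars R k))
    (hLO : littlewood_orlicz (dual (E last)))
    (p : \bar R) (hp : (0 < p)%E)
    (hsump : ((n%:R - 3 / 2)%:E <= \sum_(i < n) (ps i)^-1 - p^-1)%E) :
  (forall A : (forall i, E i) -> (scalars R k)^o,
     continuous_multilinear E (scalars R k)^o A -> hat_bounded p ps A) /\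
  continuous_multilinear E (scalars R k)^o = absolutely_summing E (scalars R k)^o p ps /\
  (forall (A : (forall i, E i) -> (scalars R k)^o) (C : R),
     continuous_multilinear E (scalars R k)^o A -> littlewood_orlicz_with (dual (E last)) C ->
     (hat_norm p ps A <= C%:E * multilinear_norm A)%E).
Proof.
have n0 : (0 < n)%N by exact: leq_trans hn.
(* The given constant may be negative; it can always be enlarged. *)
have [C C0 LO] : exists2 C, 0 <= C & littlewood_orlicz_with (dual (E last)) C.
  have [C LO] := hLO; exists (Num.max C 0); first by rewrite le_max lexx orbT.
  by apply: littlewood_orlicz_le LO; rewrite le_max lexx.
have [p1 _ hsump'] := summing_exponents hps hpn hp hsump.
split => [A cmA|].
  have [M [M0 _ AM]] := multilinear_norm_fin n0 cmA.
  exact: (hat_boundedP hn hps hpn hp hsump cmA.1 M0 AM C0 LO).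
split.
  apply/seteqP; split => A; last by case.
  move=> cmA; split => //.
    (* That 1/p is at most the sum of the 1/p_i follows from n - 3/2 > 0. *)
    rewrite (eq_bigr (fun i => (fine (ps i)^-1)%:E)); last first.
      by move=> i _; rewrite -inve_ge1_fin.
    rewrite sumEFin (inve_ge1_fin p1) lee_fin.
    have : 2 <= n%:R :> R by rewrite ler_nat.
    move: hsump'; lra.
  have [M [M0 _ AM]] := multilinear_norm_fin n0 cmA.
  (* The summand 1 makes the constant strictly positive. *)
  exists (C * M + 1); first by rewrite ltr_wpDl// mulr_ge0.
  move=> N x xN.
  have /choice[m mP] i : exists r : R, 0 <= r /\ weak_lp_norm (ps i) (x i) = r%:E.
    have [|r r0 rE] := weak_lp_norm_fin (x := x i) (hps i); last by exists r.
    move=> f; apply: (@le_lt_trans _ _ (\sum_(j < N) rnorm (f (x i j)))%:E); last exact: ltry.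
    by apply: lp_norm_finite_support => // j /xN ->; rewrite dual_fun0.
  have m0 i : 0 <= m i by have [] := mP i.
  rewrite (eq_bigr (fun i => (m i)%:E)); last by move=> i _; have [] := mP i.
  rewrite prodEFin -EFinM.
  have xm i : (weak_lp_norm (ps i) (x i) <= (m i)%:E)%E by have [_ ->] := mP i.
  apply: le_trans (lp_norm_hat_le hn hps hpn hp hsump cmA.1 M0 AM C0 LO m0 xm) _.
  by rewrite lee_fin ler_wpM2r ?prodr_ge0// lerDl.
move=> A {C0 LO}C cmA LO; have [M [M0 ME AM]] := multilinear_norm_fin n0 cmA.
have [C0|C0] := leP 0 C.
  apply: ge_ereal_sup => _ [x [_ x1] <-]; rewrite ME -EFinM.
  have := lp_norm_hat_le hn hps hpn hp hsump cmA.1 M0 AM C0 LO (fun=> ler01) x1.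
  by rewrite big1 ?mulr1.
(* With [C] negative the dual of the last space is zero, so [A] vanishes and both sides of the bound
   are 0. *)
have A0 x : A x = 0.
  have [g gE _] := curry_last last cmA.1 M0 AM x.
  rewrite -(dfwith_self x last) -gE.
  exact: littlewood_orlicz_lt0 C0 LO _ _.
have -> : multilinear_norm A = 0%E.
  apply/eqP; rewrite ME eqe eq_le M0 andbT -lee_fin -ME.
  by apply: ge_ereal_sup => _ [x _ <-]; rewrite A0 rnorm0.
rewrite mule0; apply: ge_ereal_sup => _ [x _ <-].
apply: le_trans (lp_norm_finite_support (N := 0) p1 _) _; last by rewrite big_ord0.
by move=> j _; exact: A0.
Qed.
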